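(* Let $T$ be a signed tree on $V=V^-\sqcup V^+$. For a signed spine $S$ on $T$ let $\mathbf{N}(S)=\{\mathrm{sc}(r): r \text{ an arc of } S\}$. Then $\mathbf{N}$ is a bijection from the set of signed spines on $T$ to the set of faces (including the empty face) of the signed nested complex $\mathcal{N}(T)$, and it is a poset isomorphism: for signed spines $S,S'$, the spine $S$ is obtained from $S'$ by contracting a set of arcs if and only if $\mathbf{N}(S)\subseteq\mathbf{N}(S')$.
   Context: $V$ is a finite set partitioned as $V=V^-\sqcup V^+$, $T$ a tree with vertex set $V$. For $X\subseteq V$, $X^\pm=X\cap V^\pm$; $T\setminus U$ is the forest obtained by deleting the vertices of $U$. $B\subseteq V$ is negative (resp. positive) convex if every negative (resp. positive) vertex on the path in $T$ between two vertices of $B$ lies in $B$. A signed building block is a $B\subseteq V$ that is negative convex with $V\setminus B$ positive convex; $\mathcal{B}(T)$ is their set; those other than $\emptyset,V$ are relevant. Relevant $B_1,B_2$ are signed compatible if $B_1\subseteq B_2$, or $B_2\subseteq B_1$, or ($B_1\cap B_2=\emptyset$ and $B_1\cup B_2\notin\mathcal{B}(T)$), or ($B_1\cup B_2=V$ and $B_1\cap B_2\notin\mathcal{B}(T)$). $\mathcal{N}(T)$ is the simplicial complex of sets of pairwise signed compatible relevant signed building blocks. A signed spine on $T$ is a finite directed tree $S$ whose nodes are labeled by nonempty subsets of $V$ such that (i) the labels partition $V$; (ii) for an arc $r$, $\mathrm{sc}(r)$ (resp. $\mathrm{sk}(r)$) is the union of labels of nodes in the component of $S\setminus\{r\}$ containing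 the tail (resp. head) of $r$; at each node labeled $U$, the sets $\mathrm{sc}(r)$ for distinct incoming arcs lie in pairwise distinct components of $T\setminus U^-$ and the sets $\mathrm{sk}(r)$ for distinct outgoing arcs lie in pairwise distinct components of $T\setminus U^+$. Contracting an arc from node $s$ to node $s'$ merges $s,s'$ into one node labeled by the union of their labels, all other arcs keeping their endpoints. *)

(* Defs.v *)
From mathcomp Require Import all_boot.

Set Implicit Arguments.
Unset Strict Implicit.
Unset Printing Implicit Defensive.

Section Trees.

Variable X : finType.
Implicit Types (N : {set X}) (e : rel X) (A : {set X * X}).

(* [ucycle e [:: x; y]] holds on any edge of a symmetric relation, so cycles
   of length 2 are not genuine cycles. *)
Definition acyclic e : Prop := forall c : seq X, ucycle e c -> size c <= 2.

Definition is_tree N e : Prop :=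
  [/\ N != set0,
      (forall x y, e x y -> x \in N /\ y \in N),
      symmetric e /\ irreflexive e,
      {in N &, forall x y, connect e x y} &
      acyclic e].

Definition undirected A : rel X := [rel x y | ((x, y) \in A) || ((y, x) \in A)].

(* The arc [(x, y)] has tail [x] and head [y]. *)
Definition is_directed_tree N A : Prop :=
  is_tree N (undirected A) /\ (forall x y, (x, y) \in A -> (y, x) \notin A).

Definition delete e (D : {set X}) : rel X :=
  [rel x y | [&& e x y, x \notin D & y \notin D]].

Definition components e (D : {set X}) : {set {set X}} :=
  equivalence_partition (connect (delete e D)) (~: D).

End Trees.

(* The sign partition of the vertex set is given by its negative part [neg];
   the positive part is [~: neg]. *)
Section SignedNestedComplex.

Variables (V : finType) (e : rel V) (neg : {set V}).
Implicit Types (B Z : {set V}) (F : {set {set V}}).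

(* With [Z] the set of vertices of one sign; in a tree, the duplicate-free path
   between two given vertices is unique. *)
Definition convex_for Z B : Prop :=
  forall (u : V) (p : seq V), path e u p -> uniq (u :: p) ->
    u \in B -> last u p \in B -> forall w, w \in u :: p -> w \in Z -> w \in B.

Definition signed_building_block B : Prop :=
  convex_for neg B /\ convex_for (~: neg) (~: B).

Definition relevant B : Prop :=
  [/\ signed_building_block B, B != set0 & B != setT].

Definition signed_compatible B1 B2 : Prop :=
  [\/ B1 \subset B2,
      B2 \subset B1,
      B1 :&: B2 = set0 /\ ~ signed_building_block (B1 :|: B2) |
      B1 :|: B2 = setT /\ ~ signed_building_block (B1 :&: B2)].

Definition signed_nested F : Prop :=
  {in F, forall B, relevant B} /\ {in F &, forall B1 B2, signed_compatible B1 B2}.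

End SignedNestedComplex.

(* Node labels of a spine partition the vertex set into nonempty blocks, so they
   are pairwise distinct, and each node is identified with its label: equality
   of such digraphs is label-preserving isomorphism of spines. *)
Record label_digraph (V : finType) := LabelDigraph {
  nodes : {set {set V}};
  arcs : {set {set V} * {set V}}
}.

Section Spines.

Variable V : finType.
Implicit Types (S : label_digraph V) (r : {set V} * {set V}) (U : {set V}).

Definition side S r U : {set V} :=
  cover [set W in nodes S | connect (undirected (arcs S :\ r)) U W].

Definition sc S r : {set V} := side S r r.1.
Definition sk S r : {set V} := side S r r.2.

Definition incoming S U := [set r in arcs S | r.2 == U].
Definition outgoing S U := [set r in arcs S | r.1 == U].

Definition in_distinct_components (e : rel V) (D : {set V})
    (I : {set {set V} * {set V}}) (f : {set V} * {set V} -> {set V}) : Prop :=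
  exists K : {set V} * {set V} -> {set V},
    [/\ {in I, forall r, K r \in components e D},
        {in I, forall r, f r \subset K r} &
        {in I &, injective K}].

Definition signed_spine (e : rel V) (neg : {set V}) S : Prop :=
  [/\ is_directed_tree (nodes S) (arcs S),
      partition (nodes S) [set: V],
      {in nodes S, forall U,
        in_distinct_components e (U :&: neg) (incoming S U) (sc S)} &
      {in nodes S, forall U,
        in_distinct_components e (U :&: ~: neg) (outgoing S U) (sk S)}].

Definition source_sets S : {set {set V}} := [set sc S r | r in arcs S].

Definition merge r U : {set V} :=
  if (U == r.1) || (U == r.2) then r.1 :|: r.2 else U.

Definition contract_arc S r : label_digraph V :=
  LabelDigraph (merge r @: nodes S)
    [set (merge r a.1, merge r a.2) | a in arcs S :\ r].

(* [m] maps each original node to the node of [S] it has been merged into, so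
   that [r] stands for the arc between the images of its original endpoints. *)
Fixpoint contract_seq S (m : {set V} -> {set V})
    (rs : seq ({set V} * {set V})) : label_digraph V :=
  if rs is r :: rs' then
    let r' := (m r.1, m r.2) in
    contract_seq (contract_arc S r') (merge r' \o m) rs'
  else S.

(* On a directed tree the result is independent of the order of contraction. *)
Definition contract S (R : {set {set V} * {set V}}) : label_digraph V :=
  contract_seq S id (enum R).

Definition contraction_of S S' : Prop :=
  exists2 R : {set {set V} * {set V}}, R \subset arcs S' & S = contract S' R.

End Spines.

(* Main.v *)
(* A spine is the tree representation, in the sense of Buneman, of the family [F]
   of its source sets: its nodes are the classes of vertices which no member of
   [F] separates, and an arc joins two classes separated by exactly one member.
   This describes the inverse of N, turns contractions into deletions from [F],
   and reduces the theorem to the following two facts about a family [F].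

   If [F] is signed nested, then distinct incoming source sets of a node [U] are
   separated by [U^-]. Indeed two such sets are disjoint, so their union not being
   a block yields a negative vertex outside of them that separates them; if it is
   not in [U], it lies in a third incoming source set, and one concludes by
   induction on the length of paths in [T]. The same argument shows that the class
   which should be the next node on a walk is nonempty, so that the tree exists.

   Conversely, in a spine, the walk from an arc [r] to a node [W] not in [sc r]
   either enters [W] through an incoming arc, or reaches a node having another
   incoming arc behind which [W] lies; the spine condition at that node gives
   convexity of [sc r] and compatibility of disjoint source sets.

   Statements about positive vertices follow by complementing all sets. *)

Require Import Defs.
From mathcomp Require Import all_boot.

Set Implicit Arguments.
Unset Strict Implicit.
Unset Printing Implicit Defensive.

(** * Bridges and cut vertices *)

Section Graphs.

Variable X : finType.
Implicit Types (e : rel X) (x y u v w : X) (D : {set X}).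

Definition cut_edge e x y : rel X :=
  [rel u v | [&& e u v, (u, v) != (x, y) & (u, v) != (y, x)]].

Lemma cut_edge_sym e x y : symmetric e -> symmetric (cut_edge e x y).
Proof.
move=> eS u v; rewrite /cut_edge /= eS; congr andb; rewrite andbC !xpair_eqE.
by rewrite [(u == y) && _]andbC [(u == x) && _]andbC.
Qed.

Lemma delete_sym e D : symmetric e -> symmetric (delete e D).
Proof. by move=> eS u v; rewrite /delete /= eS; congr andb; rewrite andbC. Qed.

Lemma path_delete e D u p :
  path e u p -> {in u :: p, forall w, w \notin D} -> path (delete e D) u p.
Proof.
move=> ep uD; apply: (@sub_in_path _ [pred w | w \notin D] e); last by exact: ep.
  by move=> a b; rewrite !inE /delete /= => -> -> ->.
by apply/allP=> w /uD.
Qed.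

Lemma connect_delete_path e D u v : u \notin D -> connect (delete e D) u v ->
  exists p, [/\ path e u p, uniq (u :: p), last u p = v &
                {in u :: p, forall w, w \notin D}].
Proof.
move=> uD /connectP[q /shortenP[p dp up _] ->]; exists p; split=> //.
  by apply: sub_path dp => a b /and3P[].
move=> w; rewrite inE => /predU1P[->//|].
elim: p u {q up uD} dp => //= a p IH u /andP[/and3P[_ _ aD] dp].
by rewrite inE => /predU1P[->//|]; apply: IH dp.
Qed.

(** A duplicate-free detour around an edge closes up to a cycle of length at least 3; conversely
    such a cycle minus one edge is a detour around that edge. *)
Lemma acyclicP e : symmetric e -> irreflexive e ->
  acyclic e <-> (forall x y, e x y -> ~~ connect (cut_edge e x y) x y).
Proof.
move=> eS eI; split=> [eA x y exy|eB [//|x [//|y [//|z c]]]].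
  apply/negP=> /connectP[q /shortenP[p cp up _] Ey].
  have ep : path e x p by apply: sub_path cp => a b /and3P[].
  have: ucycle e (x :: p).
    by rewrite /ucycle /= rcons_path ep -Ey eS exy.
  move/eA; case: p cp {up ep} Ey => [|a [|//]] /=.
    by move=> _ Exy; rewrite Exy eI in exy.
  by move=> + Ey; rewrite -Ey /cut_edge /= eqxx !andbF.
rewrite /ucycle /= rcons_path => /andP[/and4P[exy eyz ezc elx] /and3P[xN yN _]].
case/negP: (eB _ _ exy); rewrite sym_connect_sym; last exact: cut_edge_sym.
have P : path (cut_edge e x y) y (z :: c).
  apply: (@sub_in_path _ (predC1 x) e); last by rewrite /= eyz.
    move=> a b; rewrite !inE /cut_edge /= => ax bx ->.
    by rewrite !xpair_eqE (negPf ax) (negPf bx) andbF.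
  by apply/allP=> w wc; apply: contraNneq xN => <-.
apply: (connect_trans (y := last z c)); first by apply/connectP; exists (z :: c).
apply: connect1; rewrite /cut_edge /= elx !xpair_eqE /=.
have lz : last z c \in z :: c by exact: mem_last.
rewrite !negb_and; apply/andP; split; apply/orP; left.
  by apply: contraNneq xN => <-; rewrite inE lz orbT.
by apply: contraNneq yN => <-.
Qed.

(** Otherwise the edge by which the path enters [w] would not be a bridge: one can go back to [u],
    over to the far end avoiding [w], back along the path to the successor [b] of [w], and enter [w]
    from [b]. *)
Lemma cut_vertex e u p w : symmetric e -> irreflexive e -> acyclic e ->
  path e u p -> uniq (u :: p) -> w \in u :: p -> w != u -> w != last u p ->
  ~~ connect (delete e [set w]) u (last u p).
Proof.
move=> eS eI eA ep up; rewrite inE => /predU1P[->|]; first by rewrite eqxx.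
move=> wp wu; move: ep up; case/splitPr: wp => p1 [|b p2].
  by rewrite last_cat /= eqxx.
rewrite cat_path last_cat /= => /and4P[ep1 ew ewb ep2] up _.
have {}up : uniq ((u :: p1) ++ [:: w, b & p2]) := up.
apply/negP=> cuv.
have /negP[] := (acyclicP eS eI).1 eA _ _ ew.
have [up1 wN]: uniq (u :: p1) /\ {in u :: p1 ++ b :: p2, forall a, a != w}.
  move: up; rewrite cat_uniq => /and3P[-> /hasPn/= H].
  case/and3P=> w2 _ _; split=> // a; rewrite -cat_cons mem_cat => /orP[|] Ha.
    by apply: contraTneq Ha => ->; apply: H; rewrite inE eqxx.
  by apply: contraNneq w2 => <-.
have ab : b != last u p1.
  move: up; rewrite cat_uniq => /and3P[_ /hasPn/= H _].
  have: b \notin u :: p1 by apply: H; rewrite !inE eqxx orbT.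
  by apply: contraNneq => ->; exact: mem_last.
have D1 : connect (delete e [set w]) u (last u p1).
  apply/connectP; exists p1 => //; apply: path_delete => // a Ha.
  by rewrite inE; apply: wN; rewrite -cat_cons mem_cat Ha.
have D2 : connect (delete e [set w]) b (last b p2).
  apply/connectP; exists p2 => //; apply: path_delete => // a Ha.
  by rewrite inE; apply: wN; rewrite -cat_cons mem_cat Ha orbT.
have dS := sym_connect_sym (delete_sym [set w] eS).
have: connect (delete e [set w]) (last u p1) b.
  by rewrite dS; apply: connect_trans D2 _; rewrite dS in cuv; apply: connect_trans cuv _.
have sub : subrel (connect (delete e [set w])) (connect (cut_edge e (last u p1) w)).
  apply: connect_sub => a c /and3P[eac]; rewrite !inE => aw cw.
  by apply: connect1; rewrite /cut_edge /= eac !xpair_eqE (negPf aw) (negPf cw) andbF.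
move/sub=> H; apply: connect_trans H _; apply: connect1.
rewrite /cut_edge /= eS ewb !xpair_eqE (negPf ab) /=.
by rewrite negb_and wN // -cat_cons mem_cat inE eqxx orbT.
Qed.

End Graphs.

(** * Convex sets in a tree *)

Section Convexity.

Variables (V : finType) (e : rel V).
Hypothesis treeT : is_tree [set: V] e.
Implicit Types (Z B H U D : {set V}) (I O F : {set {set V}}) (u v w x y z : V).

Let eS : symmetric e. Proof. by case: treeT => _ _ []. Qed.
Let eI : irreflexive e. Proof. by case: treeT => _ _ []. Qed.
Let eC x y : connect e x y. Proof. by case: treeT => _ _ _ eC _; apply: eC. Qed.
Let eA : acyclic e. Proof. by case: treeT. Qed.

(** Boolean form of [convex_for], with vertex deletions in place of paths: in a tree, the inner
    vertices of the path from [u] to [v] are those whose deletion disconnects [u] from [v]. *)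
Definition convexb Z B : bool :=
  [forall w in Z :\: B, forall u in B, forall v in B,
     connect (delete e [set w]) u v].

Lemma convexb_connect Z B w u v :
  convexb Z B -> w \in Z -> w \notin B -> u \in B -> v \in B ->
  connect (delete e [set w]) u v.
Proof.
move=> /forall_inP cB wZ wB uB vB.
have /forall_inP cBw : [forall u in B, forall v in B, connect (delete e [set w]) u v].
  by apply: cB; rewrite inE wB.
by have /forall_inP := cBw u uB; apply.
Qed.

Lemma convexP Z B : reflect (convex_for e Z B) (convexb Z B).
Proof.
apply: (iffP idP) => [cB u p ep up uB lB w wp wZ|cB].
  apply: contraT => wB.
  suff /negP[] : ~~ connect (delete e [set w]) u (last u p).
    exact: convexb_connect cB wZ wB uB lB.
  by apply: (cut_vertex eS eI eA ep up wp); apply: contraNneq wB => ->.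
apply/forall_inP=> w; rewrite inE => /andP[wB wZ].
apply/forall_inP=> u uB; apply/forall_inP=> v vB.
have [q /shortenP[p ep up _] Ev] := connectP (eC u v).
rewrite Ev in vB *; apply/connectP; exists p => //; apply: path_delete => // a ap.
by rewrite inE; apply: contraNneq wB => Ea; rewrite -Ea (cB u p) // Ea.
Qed.

Lemma convexbI Z B B' : convexb Z B -> convexb Z B' -> convexb Z (B :&: B').
Proof.
move=> cB cB'; apply/forall_inP=> w; rewrite !inE negb_and => /andP[wBB wZ].
apply/forall_inP=> u; rewrite inE => /andP[uB uB'].
apply/forall_inP=> v; rewrite inE => /andP[vB vB'].
by case/orP: wBB => wB; [apply: (convexb_connect cB)|apply: (convexb_connect cB')].
Qed.

Lemma convexb0 Z : convexb Z set0.
Proof. by apply/forall_inP=> w _; apply/forall_inP=> u; rewrite inE. Qed.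

Lemma convexbT Z : convexb Z setT.
Proof. by apply/forall_inP=> w; rewrite setDT inE. Qed.

Lemma convexb_connect_set Z B D u v :
  convexb Z B -> D \subset Z -> [disjoint D & B] -> u \in B -> v \in B ->
  connect (delete e D) u v.
Proof.
move=> /convexP cB DZ DB uB vB.
have [q /shortenP[p ep up _] Ev] := connectP (eC u v).
rewrite Ev in vB *; apply/connectP; exists p => //; apply: path_delete => // w wp.
apply/negP=> wD; have wB := cB u p ep up uB vB w wp (subsetP DZ w wD).
by rewrite (disjointFr DB wD) in wB.
Qed.

(* A shortest path between two distinct branches of type [I] crosses [Z] outside
   both of them; the crossing cannot lie in a branch of type [O], and lying in
   a third branch of type [I] would give a shorter path. *)
Lemma branches_separated Z I O :
  {in I :|: O &, forall H H', H != H' -> [disjoint H & H']} ->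
  {in I, forall H, convexb Z H} -> {in O, forall H, convexb Z (~: H)} ->
  {in I &, forall H H', H != H' -> ~~ convexb Z (H :|: H')} ->
  {in I &, forall H H', H != H' -> {in H & H', forall u v,
     ~~ connect (delete e (~: cover (I :|: O) :&: Z)) u v}}.
Proof.
move=> dIO cI cO nIO H H' IH IH' HH' u v uH vH'.
set D := _ :&: Z.
have cov A a : A \in I :|: O -> a \in A -> a \in cover (I :|: O).
  by move=> AIO aA; apply/bigcupP; exists A.
have uD : u \notin D by rewrite !inE negb_and negbK (cov H) // inE IH.
apply/negP=> /(connect_delete_path uD)[p [ep up Ev pD]].
suff [w wp wD] : exists2 w, w \in u :: p & w \in D by move: (pD w wp); rewrite wD.
move: ep up {uD pD} vH'; rewrite -Ev {v Ev}.
have [n le_n] := ubnP (size p).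
elim: n p H' IH' HH' le_n => // n IHn p H' IH' HH' le_n ep up lH'.
have dj A a : A \in I :|: O -> a \in A -> a \notin H :|: H' -> 
    [disjoint A & H] /\ [disjoint A & H'].
  move=> AIO aA; rewrite inE negb_or => /andP[aH aH'].
  split; apply: dIO; rewrite // ?inE ?IH ?IH' //.
    by apply: contraNneq aH => <-.
  by apply: contraNneq aH' => <-.
(* As each of the two branches is convex, a failure of convexity of their union separates a vertex
   of one from a vertex of the other. *)
have [w [wZ wHH [a [b [aH bH' nab]]]]] : exists w, [/\ w \in Z, w \notin H :|: H' &
    exists a b, [/\ a \in H, b \in H' & ~~ connect (delete e [set w]) a b]].
  have:= nIO _ _ IH IH' HH'; rewrite negb_forall_in => /exists_inP[w].
  rewrite inE => /andP[wHH wZ]; rewrite negb_forall_in => /exists_inP[a aHH].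
  rewrite negb_forall_in => /exists_inP[b bHH nab]; exists w; split=> //.
  move: (wHH); rewrite inE negb_or => /andP[wH wH'].
  move: aHH bHH; rewrite !inE => /orP[] ah /orP[] bh.
  - by rewrite (convexb_connect (cI _ IH)) in nab.
  - by exists a, b.
  - by exists b, a; rewrite (sym_connect_sym (delete_sym _ eS)).
  - by rewrite (convexb_connect (cI _ IH')) in nab.
have [wH wH'] : w \notin H /\ w \notin H'.
  by apply/andP; rewrite -negb_or -in_setU.
have wp : w \in u :: p.
  apply: contraNT nab => wp.
  apply: (connect_trans (y := u)); first exact: (convexb_connect (cI _ IH)).
  apply: (connect_trans (y := last u p)); last exact: (convexb_connect (cI _ IH')).
  apply/connectP; exists p => //; apply: path_delete => // c cp.
  by rewrite inE; apply: contraNneq wp => <-.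
have [wcov|wncov] := boolP (w \in cover (I :|: O)); last first.
  by exists w; rewrite // /D !inE wncov.
have /bigcupP[A AIO wA] := wcov.
have [dAH dAH'] := dj A w AIO wA wHH.
(* For [A] in [O], the convex complement of [A] contains both [a] and [b], so [w] could not separate
   them. *)
move: (AIO); rewrite inE => /orP[IA|OA]; last first.
  case/negP: nab; apply: (convexb_connect (cO _ OA) wZ); rewrite !inE ?negbK //.
    by rewrite (disjointFl dAH aH).
  by rewrite (disjointFl dAH' bH').
have HA : H != A by apply: contraNneq wH => ->.
have {}wp : w \in p by move: wp wH; rewrite inE => /predU1P[->|//]; rewrite uH.
(* The initial segment ending at [w] leads from [H] to [A]; it is strictly shorter because the whole
   path ends in [H'], which misses [w]. *)
move: ep up lH' le_n; case/splitPr: wp => p1 [|c p2].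
  by rewrite last_cat /= (negPf wH').
rewrite -cat_rcons cat_path -cat_cons cat_uniq => /andP[ep1 _] /andP[up1 _] _ le_n.
have lA : last u (rcons p1 w) \in A by rewrite last_rcons.
have lt_n : size (rcons p1 w) < n.
  by rewrite -ltnS; apply: leq_trans le_n; rewrite size_cat addnS !ltnS leq_addr.
have [a' a'p a'D] := IHn _ _ IA HA lt_n ep1 up1 lA.
by exists a' => //; rewrite mem_cat a'p.
Qed.

End Convexity.

(** * Tree representation of cross-free families *)

Section SplitSystems.

Variable V : finType.
Implicit Types (B C U W A : {set V}) (F G : {set {set V}}) (x y z : V).

(** In the tree represented by [F], these are the source sets of the arcs on the walk between the
    nodes of [x] and [y]. *)
Definition sepset F x y : {set {set V}} :=
  [set B in F | (x \in B) != (y \in B)].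

Definition cl F x : {set V} := [set y | sepset F x y == set0].

(** An arc given by representatives: [B] is the source set, [x] lies in the label of the tail and
    [y] in that of the head. *)
Definition link F B x y : bool := (sepset F x y == [set B]) && (x \in B).

(** The alternatives correspond to the four quadrants cut out by [B] and [C], one of which has to be
    empty. *)
Definition crossfree F : Prop :=
  {in F &, forall B C,
    [|| B \subset C, C \subset B, [disjoint B & C] | B :|: C == setT]}.

Definition nontrivial F : Prop := set0 \notin F /\ setT \notin F.

(* The walk from [x] to [y] in the tree described by [F] has a first step. *)
Definition stepwise F : Prop := forall x y, sepset F x y != set0 ->
  exists B z, B \in sepset F x y /\ sepset F x z = [set B].

Definition treelike F : Prop := [/\ nontrivial F, crossfree F & stepwise F].

Definition spine_of F : label_digraph V :=
  LabelDigraph [set cl F x | x : V]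
    [set (cl F p.1, cl F p.2) | p : V * V & [exists B, link F B p.1 p.2]].

Lemma crossfree_quadrants F B C x1 x2 x3 x4 : crossfree F -> B \in F -> C \in F ->
  x1 \in B -> x1 \in C -> x2 \in B -> x2 \notin C ->
  x3 \notin B -> x3 \in C -> x4 \notin B -> x4 \notin C -> False.
Proof.
move=> cF BF CF x1B x1C x2B x2C x3B x3C x4B x4C; case/or4P: (cF _ _ BF CF).
- by move/subsetP/(_ _ x2B); rewrite (negPf x2C).
- by move/subsetP/(_ _ x3C); rewrite (negPf x3B).
- by move=> /disjointFr/(_ x1B); rewrite x1C.
- by move=> /eqP/setP/(_ x4); rewrite !inE (negPf x4B) (negPf x4C).
Qed.

Lemma sepset_sym F x y : sepset F x y = sepset F y x.
Proof. by apply/setP=> B; rewrite !inE eq_sym. Qed.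

Lemma sepset0P F x y :
  reflect {in F, forall B, (x \in B) = (y \in B)} (sepset F x y == set0).
Proof.
apply: (iffP eqP) => [/setP E B BF|E].
  by move: (E B); rewrite !inE BF /= => /negPn/eqP.
by apply/setP=> B; rewrite !inE; case BF: (B \in F); rewrite //= E ?eqxx.
Qed.

Lemma cl_refl F x : x \in cl F x.
Proof. by rewrite inE; apply/sepset0P. Qed.

Lemma cl_eq F x y : (cl F x == cl F y) = (sepset F x y == set0).
Proof.
apply/eqP/idP => [E|/sepset0P E]; first by have := cl_refl F y; rewrite -E inE.
apply/setP=> z; rewrite !inE; apply/sepset0P/sepset0P => E' B BF.
  by rewrite -E ?E'.
by rewrite E ?E'.
Qed.

Lemma cl_mem F x y B : cl F x = cl F y -> B \in F -> (x \in B) = (y \in B).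
Proof. by move/eqP; rewrite cl_eq => /sepset0P; apply. Qed.

Lemma cl_sub F x B : B \in F -> (cl F x \subset B) = (x \in B).
Proof.
move=> BF; apply/subsetP/idP => [|xB y]; first by apply; apply: cl_refl.
by rewrite inE => /sepset0P/(_ _ BF) <-.
Qed.

Lemma linkP F B x y :
  reflect [/\ B \in F, x \in B, y \notin B &
              {in F, forall C, C != B -> (x \in C) = (y \in C)}]
          (link F B x y).
Proof.
apply: (iffP andP) => [[/eqP/setP E xB]|[BF xB yB E]].
  have := E B; rewrite !inE eqxx xB => /andP[BF yB]; split=> //.
  move=> C CF CB; have := E C; rewrite !inE CF (negPf CB) /=.
  by move/negPn/eqP.
split=> //; apply/eqP/setP=> C; rewrite !inE.
have [->|CB] := eqVneq C B; first by rewrite BF xB (negPf yB).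
by case CF: (C \in F); rewrite //= E ?eqxx.
Qed.

Lemma link_sepset F B x y : link F B x y -> sepset F x y = [set B].
Proof. by case/andP=> /eqP. Qed.

Lemma sepset1_link F B x y : sepset F x y = [set B] -> link F B x y || link F B y x.
Proof.
move=> E; rewrite /link [sepset F y x]sepset_sym E eqxx /=.
by have /setP/(_ B) := E; rewrite !inE eqxx => /andP[_]; case: (x \in B); case: (y \in B).
Qed.

Lemma link_cl F B x y x' y' : cl F x = cl F x' -> cl F y = cl F y' ->
  link F B x y -> link F B x' y'.
Proof.
move=> Ex Ey /linkP[BF xB yB E]; apply/linkP; split=> //.
- by rewrite -(cl_mem Ex).
- by rewrite -(cl_mem Ey).
- by move=> C CF CB; rewrite -(cl_mem Ex) // -(cl_mem Ey) // E.
Qed.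

(* Four points on two links of [B] would lie in the four quadrants cut out by
   [B] and any other member separating two of them. *)
Lemma link_uniq F B x y x' y' : crossfree F -> link F B x y -> link F B x' y' ->
  cl F x = cl F x' /\ cl F y = cl F y'.
Proof.
move=> cF /linkP[BF xB yB E] /linkP[_ x'B y'B E'].
suff H C : C \in F -> C != B -> (x \in C) = (x' \in C).
  split; apply/eqP; rewrite cl_eq; apply/sepset0P => C CF.
    by have [->|CB] := eqVneq C B; [rewrite xB x'B|apply: H].
  have [->|CB] := eqVneq C B; first by rewrite (negPf yB) (negPf y'B).
  by rewrite -E -?E' ?H.
move=> CF CB; have := E C CF CB; have := E' C CF CB.
case xC: (x \in C); case x'C: (x' \in C) => // /esym y'C /esym yC; exfalso.
  by apply: (@crossfree_quadrants F B C x x' y y'); rewrite ?y'C ?yC ?x'C.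
by apply: (@crossfree_quadrants F B C x' x y' y); rewrite ?y'C ?yC ?xC.
Qed.

Lemma arcs_spineP F r :
  reflect (exists B x y, link F B x y /\ r = (cl F x, cl F y))
          (r \in arcs (spine_of F)).
Proof.
apply: (iffP imsetP) => [[[x y]]|[B [x [y [l ->]]]]].
  by rewrite inE => /existsP[B l] ->; exists B, x, y.
by exists (x, y) => //; rewrite inE; apply/existsP; exists B.
Qed.

Lemma mem_arcs_spine F x y :
  ((cl F x, cl F y) \in arcs (spine_of F)) = [exists B, link F B x y].
Proof.
apply/arcs_spineP/existsP => [[B [x' [y' [l [Ex Ey]]]]]|[B l]].
  by exists B; apply: link_cl l.
by exists B, x, y.
Qed.

(** Each step of a walk uses up one separating set; this drives the inductions on the number of
    separators. *)
Lemma sepset_step F C x y z : sepset F x z = [set C] -> C \in sepset F x y ->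
  sepset F z y = sepset F x y :\ C.
Proof.
move=> xz Cxy; apply/setP=> A; move/setP/(_ A): xz; move: Cxy; rewrite !inE.
case: (eqVneq A C) => [->|AC] /=.
  by case: (C \in F); case: (x \in C); case: (y \in C); case: (z \in C).
by case: (A \in F); case: (x \in A); case: (y \in A); case: (z \in A).
Qed.

(** A walk from a vertex of [B] to one outside must cross [B] at some step: while the first step
    crosses another member, [B] still separates what remains. *)
Lemma link_exists F B : nontrivial F -> stepwise F -> B \in F ->
  exists x y, link F B x y.
Proof.
move=> [F0 FT] sF BF.
have /set0Pn[x xB] : B != set0 by apply: contraNneq F0 => <-.
have /subsetPn[y _ yB] : ~~ (setT \subset B).
  by rewrite subTset; apply: contraNneq FT => <-.
have: B \in sepset F x y by rewrite inE BF xB (negPf yB).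
have [n] := ubnP #|sepset F x y|; elim: n x {xB} => // n IH x le_n Bxy.
have [|C [z [Cxy xz]]] := sF x y; first by apply/set0Pn; exists B.
have [EBC|BC] := eqVneq B C.
  by rewrite -EBC in xz; case/orP: (sepset1_link xz) => l; [exists x, z|exists z, x].
have E := sepset_step xz Cxy.
apply: (IH z); rewrite E ?in_setD1 ?BC //.
by rewrite -ltnS; apply: leq_trans le_n; rewrite ltnS [ltnRHS](cardsD1 C) Cxy.
Qed.

Lemma side_pblock (S : label_digraph V) r U z : partition (nodes S) [set: V] ->
  (z \in side S r U) = connect (undirected (arcs S :\ r)) U (pblock (nodes S) z).
Proof.
move=> /and3P[/eqP cS tS _]; have zc : z \in cover (nodes S) by rewrite cS.
apply/bigcupP/idP => [[W]|UW].
  by rewrite inE => /andP[WS UW] zW; rewrite (def_pblock tS WS zW).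
by exists (pblock (nodes S) z); rewrite ?mem_pblock // inE UW pblock_mem.
Qed.

Lemma nodes_spine_partition F : partition (nodes (spine_of F)) [set: V].
Proof.
apply/and3P; split.
- apply/eqP/setP=> x; rewrite inE; apply/bigcupP; exists (cl F x); last exact: cl_refl.
  exact: imset_f.
- apply/trivIsetP=> _ _ /imsetP[x _ ->] /imsetP[y _ ->] xy.
  rewrite -setI_eq0; apply: contraNT xy => /set0Pn[z].
  by rewrite !inE -!cl_eq => /andP[/eqP-> /eqP->].
- by apply/imsetP=> -[x _ /setP/(_ x)]; rewrite cl_refl inE.
Qed.

Lemma pblock_spine F x : pblock (nodes (spine_of F)) x = cl F x.
Proof.
have /and3P[_ tS _] := nodes_spine_partition F.
by apply: def_pblock => //; [apply: imset_f|apply: cl_refl].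
Qed.

(** The walk only crosses members separating [x] and [y]. The arc set [A] is kept general so that
    the lemma also applies after an arc is deleted. *)
Lemma connect_spine F (A : {set {set V} * {set V}}) x y : stepwise F ->
  (forall C x' y', C \in sepset F x y -> link F C x' y' -> (cl F x', cl F y') \in A) ->
  connect (undirected A) (cl F x) (cl F y).
Proof.
move=> sF; have [n] := ubnP #|sepset F x y|; elim: n x => // n IH x le_n HA.
have [xy|xy] := eqVneq (sepset F x y) set0.
  by move/eqP: xy; rewrite -cl_eq => /eqP->.
have [C [z [Cxy xz]]] := sF _ _ xy.
have E := sepset_step xz Cxy.
apply: (connect_trans (y := cl F z)).
  apply: connect1; rewrite /undirected /=.
  by case/orP: (sepset1_link xz) => /(HA _ _ _ Cxy)->; rewrite ?orbT.
apply: IH => [|D x' y']; rewrite E.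
  by rewrite -ltnS; apply: leq_trans le_n; rewrite ltnS [ltnRHS](cardsD1 C) Cxy.
by rewrite in_setD1 => /andP[_]; apply: HA.
Qed.

Lemma undirected_sym (X : finType) (A : {set X * X}) : symmetric (undirected A).
Proof. by move=> x y; rewrite /undirected /= orbC. Qed.

Lemma undirectedS (X : finType) (A A' : {set X * X}) : A \subset A' ->
  subrel (undirected A) (undirected A').
Proof.
by move/subsetP=> AA' x y /orP[] /AA' xy; rewrite /undirected /= xy ?orbT.
Qed.

Lemma sub_cut_edge (X : finType) (A : {set X * X}) (x y : X) :
  subrel (cut_edge (undirected A) x y) (undirected (A :\ (x, y))).
Proof.
move=> u v /and3P[uv N1 N2]; rewrite /undirected /= !in_setD1 N1 /=.
have -> : (v, u) != (x, y) by apply: contraNneq N2 => -[-> ->].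
exact: uv.
Qed.

(** * The directed tree of a treelike family *)

Section Treelike.

Variable F : {set {set V}}.
Hypothesis tF : treelike F.

Let cF : crossfree F. Proof. by case: tF. Qed.
Let sF : stepwise F. Proof. by case: tF. Qed.

(** Being inside [B] is invariant along every arc but the unique one of [B]; conversely, the walk
    between two vertices on the same side of [B] does not cross [B]. *)
Lemma connect_spine_del B x y z t : link F B x y ->
  connect (undirected (arcs (spine_of F) :\ (cl F x, cl F y))) (cl F z) (cl F t)
  = ((z \in B) == (t \in B)).
Proof.
move=> l; have [BF xB yB _] := linkP _ _ _ _ l.
apply/idP/idP => [H|zt].
  rewrite -!(cl_sub _ BF); apply/eqP.
  apply: (@closed_connect _ _ [pred U : {set V} | U \subset B] _ _ _ H) => U W.
  have K r : r \in arcs (spine_of F) :\ (cl F x, cl F y) ->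
      (r.1 \subset B) = (r.2 \subset B).
    rewrite in_setD1 => /andP[rN /arcs_spineP[C [x' [y' [l' Er]]]]].
    rewrite Er !cl_sub //; have [_ _ _ E'] := linkP _ _ _ _ l'.
    apply: E' => //; apply: contraNneq rN => BC; rewrite Er.
    by rewrite -BC in l'; have [-> ->] := link_uniq cF l l'.
  by rewrite !inE => /orP[] /K /= ->.
apply: connect_spine => // C x' y' Czt l'; rewrite in_setD1 mem_arcs_spine.
apply/andP; split; last by apply/existsP; exists C.
apply/eqP=> -[Ex Ey]; have := link_sepset (link_cl Ex Ey l').
rewrite (link_sepset l) => /set1_inj BC; move: Czt.
by rewrite -BC inE BF (eqP zt) eqxx.
Qed.

(** Every arc is a bridge, since by [connect_spine_del] its deletion separates its tail from its
    head. *)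
Lemma spine_directed_tree : [set: V] != set0 ->
  is_directed_tree (nodes (spine_of F)) (arcs (spine_of F)).
Proof.
move=> VN; have asym U W : (U, W) \in arcs (spine_of F) -> (W, U) \notin arcs (spine_of F).
  move=> /arcs_spineP[B [x [y [l [-> ->]]]]]; rewrite mem_arcs_spine.
  apply/existsP=> -[C l']; have := link_sepset l'.
  rewrite sepset_sym (link_sepset l) => /set1_inj BC; move: l l'; rewrite -BC.
  by move=> /linkP[_ _ yB _] /linkP[_ yB' _ _]; rewrite yB' in yB.
have arcN U W : (U, W) \in arcs (spine_of F) ->
    U \in nodes (spine_of F) /\ W \in nodes (spine_of F).
  by move=> /arcs_spineP[B [x [y [l [-> ->]]]]]; split; apply: imset_f.
have irr : irreflexive (undirected (arcs (spine_of F))).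
  by move=> U; apply/negP=> /orP[] UU; have := asym _ _ UU; rewrite UU.
split=> //; split.
- by have [x _] := set0Pn _ VN; apply/set0Pn; exists (cl F x); apply: imset_f.
- by move=> U W /orP[] /arcN[].
- by split=> //; apply: undirected_sym.
- move=> _ _ /imsetP[x _ ->] /imsetP[y _ ->]; apply: connect_spine => // C x' y' _ l.
  by rewrite mem_arcs_spine; apply/existsP; exists C.
- apply/(acyclicP (@undirected_sym _ _) irr).
  have K U W : (U, W) \in arcs (spine_of F) ->
      ~~ connect (cut_edge (undirected (arcs (spine_of F))) U W) U W.
    move=> /arcs_spineP[B [x [y [l [-> ->]]]]]; apply/negP=> H.
    have: connect (undirected (arcs (spine_of F) :\ (cl F x, cl F y))) (cl F x) (cl F y).
      by apply: connect_sub H => a b /sub_cut_edge; apply: connect1.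
    rewrite (connect_spine_del _ _ l); case/linkP: l => _ -> /negPf -> //.
  move=> U W /orP[] UW; first exact: K.
  rewrite (sym_connect_sym (cut_edge_sym _ _ (@undirected_sym _ _))).
  apply: contra (K _ _ UW); apply: connect_sub => a b /and3P[ab N1 N2].
  by apply: connect1; rewrite /cut_edge /= ab N1 N2.
Qed.

Lemma sc_spine B x y : link F B x y -> sc (spine_of F) (cl F x, cl F y) = B.
Proof.
move=> l; apply/setP=> z; rewrite side_pblock ?nodes_spine_partition //.
by rewrite pblock_spine (connect_spine_del _ _ l); case/linkP: l => _ ->.
Qed.

Lemma sk_spine B x y : link F B x y -> sk (spine_of F) (cl F x, cl F y) = ~: B.
Proof.
move=> l; apply/setP=> z; rewrite side_pblock ?nodes_spine_partition //.
by rewrite pblock_spine (connect_spine_del _ _ l) inE; case/linkP: l => _ _ /negPf ->.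
Qed.

Lemma source_sets_spine : source_sets (spine_of F) = F.
Proof.
apply/setP=> B; apply/imsetP/idP => [[r /arcs_spineP[C [x [y [l ->]]]] ->]|BF].
  by rewrite (sc_spine l); case/linkP: l.
have [pF _ _] := tF; have [x [y l]] := link_exists pF sF BF.
exists (cl F x, cl F y); last by rewrite (sc_spine l).
by rewrite mem_arcs_spine; apply/existsP; exists B.
Qed.

End Treelike.

(** * Signed nested families *)

(** Complementing every member reverses the arcs of the represented tree, exchanging source and sink
    sets; it carries statements about one sign over to the other. *)
Definition compl F : {set {set V}} := [set ~: B | B in F].

Lemma mem_compl F B : (B \in compl F) = (~: B \in F).
Proof. by rewrite -[B in LHS]setCK mem_imset //; apply: (can_inj (@setCK V)). Qed.

Lemma sepset_compl F x y : sepset (compl F) x y = compl (sepset F x y).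
Proof.
apply/setP=> B; rewrite mem_compl !inE mem_compl.
by case: (x \in B); case: (y \in B).
Qed.

Lemma compl1 B : compl [set B] = [set ~: B].
Proof. exact: imset_set1. Qed.

Lemma cl_compl F x : cl (compl F) x = cl F x.
Proof. by apply/setP=> y; rewrite !inE sepset_compl imset_eq0. Qed.

Lemma link_compl F B x y : link (compl F) (~: B) y x = link F B x y.
Proof.
apply/linkP/linkP => [[]|[BF xB yB E]].
  rewrite mem_compl setCK !inE negbK => BF yB xB E; split=> // C CF CB.
  have := E (~: C); rewrite mem_compl setCK CF (can_eq (@setCK V)) CB !inE.
  by move=> /(_ isT isT); case: (x \in C); case: (y \in C).
rewrite mem_compl setCK !inE negbK; split=> // C; rewrite mem_compl => CF CB.
have := E _ CF; rewrite -(can_eq (@setCK V)) setCK CB !inE => /(_ isT).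
by case: (x \in C); case: (y \in C).
Qed.

(** Replacing a set by its complement only permutes the four quadrants. *)
Lemma crossfree_side F A A' : crossfree F -> (A \in F) || (~: A \in F) ->
  (A' \in F) || (~: A' \in F) ->
  [|| A \subset A', A' \subset A, [disjoint A & A'] | A :|: A' == setT].
Proof.
move=> cF AF A'F; apply: contraT; rewrite !negb_or => /and4P[].
move=> /subsetPn[x2 x2A x2A'] /subsetPn[x3 x3A' x3A].
rewrite -setI_eq0 => /set0Pn[x1]; rewrite inE => /andP[x1A x1A'].
rewrite -subTset => /subsetPn[x4 _]; rewrite inE negb_or => /andP[x4A x4A'].
case/orP: AF => AF; case/orP: A'F => A'F; exfalso.
- exact: (crossfree_quadrants cF AF A'F (x1 := x1) (x2 := x2) (x3 := x3) (x4 := x4)).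
- by apply: (crossfree_quadrants cF AF A'F (x1 := x2) (x2 := x1) (x3 := x4) (x4 := x3));
    rewrite ?inE ?negbK.
- by apply: (crossfree_quadrants cF AF A'F (x1 := x3) (x2 := x4) (x3 := x1) (x4 := x2));
    rewrite ?inE ?negbK.
- by apply: (crossfree_quadrants cF AF A'F (x1 := x4) (x2 := x3) (x3 := x2) (x4 := x1));
    rewrite ?inE ?negbK.
Qed.

Lemma nontrivial_compl F : nontrivial F -> nontrivial (compl F).
Proof. by case=> F0 FT; split; rewrite mem_compl ?setC0 ?setCT. Qed.

Lemma crossfree_compl F : crossfree F -> crossfree (compl F).
Proof.
move=> cF B C; rewrite !mem_compl => BF CF.
by apply: (crossfree_side cF); rewrite ?BF ?CF orbT.
Qed.

Lemma treelike_compl F : treelike F -> treelike (compl F).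
Proof.
case=> pF cF sF; split; [exact: nontrivial_compl|exact: crossfree_compl|].
move=> x y; rewrite sepset_compl imset_eq0 => /sF[B [z [Bxy xz]]].
by exists (~: B), z; rewrite !sepset_compl xz compl1 mem_compl setCK.
Qed.

(** Follow the walk from [B] towards the node of [w] until it would first go against the direction
    of an arc: [A] is the last arc crossed forwards and [z] lies in its head. Then either [w] has
    been reached, or [w] lies behind another arc entering that node. *)
Lemma link_approach F B w : treelike F -> B \in F -> w \notin B ->
  exists A a z, [/\ B \subset A, w \notin A, link F A a z &
    cl F z = cl F w \/ exists A' a', [/\ A' != A, link F A' a' z & w \in A']].
Proof.
case=> pF cF sF BF wB.
pose P A := [&& A \in F, B \subset A & w \notin A].
have PB : P B by rewrite /P BF subxx.
case: (arg_maxnP (fun A => #|A|) PB) => A /and3P[AF BA wA] Amax.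
have [a [z l]] := link_exists pF sF AF; have [_ aA zA E] := linkP _ _ _ _ l.
exists A, a, z; split=> //.
have [zw|/sF[C [t [Czw zt]]]] := eqVneq (sepset F z w) set0.
  by left; apply/eqP; rewrite cl_eq zw.
(* If the next arc [C] left the node of [z], it would contain [a], and cross-freeness would put [A]
   strictly inside [C], against maximality; hence it enters that node. *)
right; case/orP: (sepset1_link zt) => l'; have [CF tC zC _] := linkP _ _ _ _ l'.
  move: Czw; rewrite inE CF tC /= => Cw.
  have wC : w \notin C by case: (w \in C) Cw.
  have CA : C != A by apply: contraNneq zA => <-.
  have aC : a \in C by rewrite E.
  have AC : A \subset C.
    apply/subsetP=> b bA; apply: contraT => bC; exfalso.
    exact: (crossfree_quadrants cF AF CF (x1 := a) (x2 := b) (x3 := z) (x4 := w)).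
  have: P C by rewrite /P CF (subset_trans BA AC).
  move/Amax => /=; rewrite leqNgt proper_card // properE AC.
  by apply/subsetPn; exists z.
have wC : w \in C.
  by move: Czw; rewrite inE CF (negPf zC) /=; case: (w \in C).
by exists C, t; split=> //; apply: contraNneq wA => <-.
Qed.

Section SignedTree.

Variable e : rel V.
Hypothesis treeT : is_tree [set: V] e.

Let eS : symmetric e. Proof. by case: treeT => _ _ []. Qed.

(* The half of signed nestedness, and of the spine condition, that involves
   vertices of one sign [Z]; the other half is obtained by complementing. *)
Definition half_nested (Z : {set V}) F : Prop :=
  {in F, forall B, convexb e Z B} /\
  {in F &, forall B B', [disjoint B & B'] -> ~~ convexb e Z (B :|: B')}.

Definition half_spine (Z : {set V}) F : Prop := forall x B B' y y',
  link F B y x -> link F B' y' x ->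
  {in B & B', forall u v, connect (delete e (cl F x :&: Z)) u v = (B == B')}.

Lemma blockP neg B :
  signed_building_block e neg B <-> convexb e neg B && convexb e (~: neg) (~: B).
Proof.
split=> [[cB cB']|/andP[cB cB']]; first by apply/andP; split; apply/(convexP treeT).
by split; apply/(convexP treeT).
Qed.

(** For disjoint blocks, the complement of the union is an intersection of positive convex sets, so
    only negative convexity of the union can fail. Dually, blocks covering [V] have disjoint
    complements, and only positive convexity is at stake. *)
Lemma signed_nestedP neg F : signed_nested e neg F <->
  [/\ nontrivial F, crossfree F, half_nested neg F & half_nested (~: neg) (compl F)].
Proof.
split=> [[rF sF]|[[F0 FT] cF [h1 h2] [h1' h2']]].
  have cv B : B \in F -> convexb e neg B /\ convexb e (~: neg) (~: B).
    by move/rF=> [/blockP/andP].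
  have pF : nontrivial F.
    by split; apply/negP=> /rF[_]; rewrite eqxx.
  have N0 B : B \in F -> B != set0 by move=> BF; apply: contraNneq pF.1 => <-.
  have NT B : B \in F -> B != setT by move=> BF; apply: contraNneq pF.2 => <-.
  (* The blocks [set0] and [setT] exclude pairs that are at once disjoint and covering; for these
     the two last clauses of compatibility would overlap. *)
  have b0 : signed_building_block e neg set0.
    by apply/blockP; rewrite convexb0 setC0 convexbT.
  have bT : signed_building_block e neg setT.
    by apply/blockP; rewrite setCT convexb0 convexbT.
  split=> //.
  - move=> B C BF CF; case: (sF _ _ BF CF) => [->|->|[]|[]]; rewrite ?orbT //.
      by move/eqP; rewrite setI_eq0 => ->; rewrite !orbT.
    by move=> ->; rewrite eqxx !orbT.
  - split=> [B /cv[] //|B C BF CF dBC]; apply/negP=> cU.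
    have [_ cB'] := cv _ BF; have [_ cC'] := cv _ CF.
    case: (sF _ _ BF CF) => [BC|CB|[_ []]|[_ []]].
    + by move: dBC; rewrite -setI_eq0 (setIidPl BC) (negPf (N0 _ BF)).
    + by move: dBC; rewrite -setI_eq0 (setIidPr CB) (negPf (N0 _ CF)).
    + by apply/blockP; rewrite cU setCU convexbI.
    + by move: dBC; rewrite -setI_eq0 => /eqP->.
  - split=> [B|B C]; rewrite !mem_compl; first by move/cv; rewrite setCK => -[].
    move=> BF CF dBC; apply/negP=> cU.
    have [cB _] := cv _ BF; have [cC _] := cv _ CF.
    have dBC' : ~: B :|: ~: C = setT.
      by rewrite -setCI; move: dBC; rewrite -setI_eq0 => /eqP->; rewrite setC0.
    case: (sF _ _ BF CF) => [BC|CB|[_ []]|[_ []]].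
    + by move: dBC'; rewrite (setUidPr BC) => /eqP; rewrite (negPf (NT _ CF)).
    + by move: dBC'; rewrite (setUidPl CB) => /eqP; rewrite (negPf (NT _ BF)).
    + by rewrite dBC'.
    + by apply/blockP; rewrite convexbI // setCI !setCK.
split=> [B BF|B C BF CF].
  split; [|by apply: contraNneq F0 => <-|by apply: contraNneq FT => <-].
  by apply/blockP; rewrite h1 //= h1' // mem_compl setCK.
case/or4P: (cF _ _ BF CF) => [BC|CB|dBC|/eqP UBC]; [by constructor 1|by constructor 2| |].
  constructor 3; split; first by apply/eqP; rewrite setI_eq0.
  by move/blockP=> /andP[cU _]; move: (h2 _ _ BF CF dBC); rewrite cU.
constructor 4; split=> // /blockP/andP[_]; apply/negP; rewrite setCI; apply: h2'.
- by rewrite mem_compl setCK.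
- by rewrite mem_compl setCK.
- by rewrite -setI_eq0 -setCU UBC setCT.
Qed.

(** The maximal members of [S] have the same cover as [S], and are pairwise disjoint because the
    family is cross-free and no two of them cover [V]. Sorted by whether they or their complements
    lie in [F], they are the branches [I] and [O] of [branches_separated]. *)
Lemma sides_separated Z F (S : {set {set V}}) A A' a a' :
  crossfree F -> half_nested Z F ->
  {in S, forall C, (C \in F) || (~: C \in F)} ->
  {in S &, forall C C', C :|: C' != setT} ->
  maxset (mem S) A -> maxset (mem S) A' -> A != A' -> A \in F -> A' \in F ->
  a \in A -> a' \in A' -> ~~ connect (delete e (~: cover S :&: Z)) a a'.
Proof.
move=> cF [h1 h2] sS uS mA mA' AA' AF A'F aA aA'.
pose M := [set C | maxset (mem S) C].
have MS C : C \in M -> C \in S by rewrite inE => /maxsetp.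
have dM : {in M &, forall H H' : {set V}, H != H' -> [disjoint H & H']}.
  move=> H H' mH mH' HH'.
  case/or4P: (crossfree_side cF (sS _ (MS _ mH)) (sS _ (MS _ mH'))) => //.
  - move=> sub; move: mH; rewrite inE => /maxsetP[_ /(_ H' (MS _ mH') sub) E].
    by rewrite E eqxx in HH'.
  - move=> sub; move: mH'; rewrite inE => /maxsetP[_ /(_ H (MS _ mH) sub) E].
    by rewrite E eqxx in HH'.
  - by rewrite (negPf (uS _ _ (MS _ mH) (MS _ mH'))).
have EM : (M :&: F) :|: [set C in M | ~: C \in F] = M.
  apply/setP=> C; rewrite !in_setU in_setI in_set -andb_orr.
  by have [/MS/sS->|] := boolP (C \in M).
have -> : cover S = cover ((M :&: F) :|: [set C in M | ~: C \in F]).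
  rewrite EM; apply/setP=> z; apply/bigcupP/bigcupP => -[C CS zC].
    have [C' mC' CC'] := maxset_exists (P := mem S) CS.
    by exists C'; [rewrite inE|apply: (subsetP CC')].
  by exists C; first exact: MS.
apply: (branches_separated treeT _ _ _ _ _ _ AA' aA aA').
- by rewrite EM.
- by move=> H; rewrite inE => /andP[_ /h1].
- by move=> H; rewrite inE => /andP[_ /h1].
- move=> H H'; rewrite !in_setI => /andP[mH HF] /andP[mH' H'F] HH'.
  by apply: h2 => //; apply: dM.
- by rewrite !inE mA.
- by rewrite !inE mA'.
Qed.

(** The sides of members of [F] that avoid [x] cover exactly the complement of its class, and the
    source sets of arcs entering this class are maximal among them, so [sides_separated] applies. *)
Lemma half_nested_spine Z F : crossfree F -> half_nested Z F -> half_spine Z F.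
Proof.
move=> cF hF x B B' y y' l l' u v uB vB'.
have [BF yB xB E] := linkP _ _ _ _ l; have [B'F yB' xB' E'] := linkP _ _ _ _ l'.
have [EB|BB'] := eqVneq B B'.
  rewrite -EB in vB'; apply: (convexb_connect_set treeT (hF.1 _ BF)) => //.
    exact: subsetIr.
  rewrite -setI_eq0; apply/eqP/setP=> w; rewrite !inE.
  case: eqP => //= /eqP; rewrite -cl_eq => /eqP/cl_mem/(_ BF) <-.
  by rewrite (negPf xB) andbF.
pose side C := if x \in C then ~: C else C.
have xN C : x \notin side C by rewrite /side; case: ifP => [|->]; rewrite // inE => ->.
have -> : cl F x = ~: cover (side @: F).
  apply/setP=> w; rewrite inE in_setC.
  apply/sepset0P/negP => [Ew /bigcupP[_ /imsetP[C CF ->]]|N C CF].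
    by rewrite /side Ew //; case: ifP => [|->]; rewrite // inE => ->.
  case xC: (x \in C); case wC: (w \in C) => //; case: N;
    apply/bigcupP; exists (side C); rewrite ?imset_f //.
    by rewrite /side xC inE wC.
  by rewrite /side xC wC.
(* A side containing [C] contains its tail vertex [c], but a side of any other member contains [c]
   only if it contains [x]. *)
have mx C c : link F C c x -> maxset (mem (side @: F)) C.
  move=> lC; have [CF cC xC EC] := linkP _ _ _ _ lC.
  apply/maxsetP; split; first by apply/imsetP; exists C; rewrite // /side (negPf xC).
  move=> _ /imsetP[D DF ->] /subsetP/(_ _ cC) cD; apply: contraTeq cD => DC.
  have DC' : D != C by apply: contraNneq DC => ->; rewrite /side (negPf xC).
  suff -> : (c \in side D) = (x \in side D) by apply: xN.
  by rewrite /side; case: ifP => _; rewrite ?inE EC.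
apply: negbTE; apply: sides_separated hF _ _ (mx _ _ l) (mx _ _ l') BB' BF B'F uB vB' => //.
  by move=> _ /imsetP[C CF ->]; rewrite /side; case: ifP => _; rewrite ?setCK CF ?orbT.
move=> _ _ /imsetP[C CF ->] /imsetP[D DF ->]; apply/eqP=> /setP/(_ x).
by rewrite inE (negPf (xN C)) (negPf (xN D)) inE.
Qed.

(* Among the sides of the members of [F] pointing away from the second node of
   the walk from [x] to [y], three maximal ones would cover the tree if that node
   had no label; two of them are then of the same type, yet no vertex can
   separate them. *)
Lemma half_nested_stepwise neg F : nontrivial F -> crossfree F ->
  half_nested neg F -> half_nested (~: neg) (compl F) -> stepwise F.
Proof.
move=> pF cF hF hF' x y /set0Pn[B0 B0xy].
pose xs C := if x \in C then C else ~: C.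
have xxs C : x \in xs C by rewrite /xs; case: ifP => // xC; rewrite inE xC.
have xsF C : C \in F -> (xs C \in F) || (~: xs C \in F).
  by move=> CF; rewrite /xs; case: ifP; rewrite ?setCK CF ?orbT.
have yxs C : C \in F -> (y \in xs C) = (C \notin sepset F x y).
  move=> CF; rewrite inE CF /xs; case: ifP => [|] xC; rewrite ?inE.
    by case: (y \in C).
  by case: (y \in C).
(* The separator with the smallest side around [x] is the first arc of the walk to [y]. *)
case: (arg_minnP (fun C => #|xs C|) B0xy) => B + Bmin.
rewrite -[X in is_true X]/(B \in sepset F x y) => Bxy.
have BF : B \in F by move: Bxy; rewrite inE => /andP[].
have Ncompl C : C \in F -> ~: C \in F -> False.
  move=> CF CF'; have := hF.2 _ _ CF CF'.
  by rewrite disjoints_subset setCK subxx setUCr convexbT => /(_ isT).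
have xs_inj C : C \in F -> xs C = xs B -> C = B.
  move=> CF; rewrite /xs; case: ifP; case: ifP => // _ _ E.
  - by have := Ncompl B BF; rewrite -E CF => /(_ isT).
  - by have := Ncompl C CF; rewrite E BF => /(_ isT).
  - exact: setC_inj.
(* Sides pointing away from the second node, which differs from the node of [x] only with respect to
   [B]. *)
pose side C := if C == B then xs C else ~: xs C.
have xside C : C != B -> x \notin side C by move=> /negPf CB; rewrite /side CB in_setC xxs.
have yside C : C \in F -> (C == B) || (C \notin sepset F x y) -> y \notin side C.
  move=> CF; rewrite /side; case: eqP => [->|_] /=; first by rewrite yxs // Bxy.
  by rewrite in_setC yxs // => ->.
have sF : {in side @: F, forall C, (C \in F) || (~: C \in F)}.
  move=> _ /imsetP[C /xsF H ->]; rewrite /side; case: ifP => // _.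
  by rewrite setCK orbC.
(* If [C] does not separate [x] and [y], then [y] is missed by both sides; otherwise minimality puts
   [xs B] properly inside [xs C], and a vertex of the difference is missed. *)
have uB C : C \in F -> C != B -> xs B :|: side C != setT.
  move=> CF CB; have [Cxy|Cxy] := boolP (C \in sepset F x y); last first.
    apply/eqP=> /setP/(_ y); rewrite in_setU in_setT yxs // Bxy /=.
    by rewrite (negPf (yside _ _ _)) // Cxy orbT.
  have : [|| xs C \subset xs B, xs B \subset xs C, [disjoint xs C & xs B] |
            xs C :|: xs B == setT] by apply: crossfree_side cF _ _; apply: xsF.
  have ne : xs C != xs B by apply: contraNneq CB => /xs_inj->.
  have S1 : xs B \subset xs C -> xs B :|: side C != setT.
    move=> sub; have /properP[_ [z zC zB]] : xs B \proper xs C.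
      by rewrite properEneq eq_sym ne.
    apply/eqP=> /setP/(_ z).
    by rewrite /side (negPf CB) in_setU in_setC in_setT zC (negPf zB).
  case/or4P=> //.
  - move=> sub; have := Bmin _ Cxy; rewrite leqNgt proper_card // properEneq sub.
    by rewrite ne.
  - by move=> /disjointFr/(_ (xxs C)); rewrite xxs.
  - by move=> /eqP/setP/(_ y); rewrite in_setU in_setT !yxs // Bxy Cxy.
have uS : {in side @: F &, forall C C', C :|: C' != setT}.
  move=> _ _ /imsetP[C CF ->] /imsetP[C' CF' ->].
  have [->|CB] := eqVneq C B; have [->|CB'] := eqVneq C' B.
  - by apply/eqP=> /setP/(_ y); rewrite in_setU in_setT (negPf (yside _ _ _)) // eqxx.
  - by rewrite {1}/side eqxx uB.
  - by rewrite setUC {1}/side eqxx uB.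
  - apply/eqP=> /setP/(_ x).
    by rewrite in_setU in_setT (negPf (xside _ CB)) (negPf (xside _ CB')).
(* A vertex outside all the sides lies in the label of the second node. *)
suff /subsetPn[z _ zN] : ~~ (setT \subset cover (side @: F)).
  exists B, z; split=> //; apply/setP=> C; rewrite !inE.
  case CF: (C \in F); last by case: (eqVneq C B) => // CB; rewrite CB BF in CF.
  have zC : z \notin side C.
    by apply: contra zN => zC; apply/bigcupP; exists (side C); rewrite ?imset_f.
  move: zC; rewrite /side; case: (eqVneq C B) => _; rewrite /xs; case: ifP => _;
    rewrite ?inE ?negbK => zC.
  - by rewrite (negPf zC).
  - by rewrite zC.
  - by rewrite zC.
  - by rewrite (negPf zC).
apply/negP; rewrite subTset => /eqP covT.
have mxs z : exists2 A, maxset (mem (side @: F)) A & z \in A.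
  have /bigcupP[C CS zC] : z \in cover (side @: F) by rewrite covT inE.
  have [A mA CA] := maxset_exists (P := mem (side @: F)) CS.
  by exists A => //; apply: (subsetP CA).
have D0 Z : delete e (~: cover (side @: F) :&: Z) =2 e.
  by move=> a b; rewrite covT setCT set0I /delete /= !inE !andbT.
have eD Z a b : connect (delete e (~: cover (side @: F) :&: Z)) a b.
  by rewrite (eq_connect (D0 Z)); case: treeT => _ _ _ eC _; apply: eC.
(* When the sides cover [V], nothing is deleted and the tree stays connected, so no two maximal
   sides can be of the same type. *)
have NI A A' a a' : maxset (mem (side @: F)) A -> maxset (mem (side @: F)) A' ->
    A != A' -> a \in A -> a' \in A' ->
    ~~ ((A \in F) && (A' \in F)) /\ ~~ ((~: A \in F) && (~: A' \in F)).
  move=> mA mA' AA' aA aA'; split; apply/negP=> /andP[AF AF'].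
    by move: (sides_separated cF hF sF uS mA mA' AA' AF AF' aA aA'); rewrite eD.
  have sF' : {in side @: F, forall C, (C \in compl F) || (~: C \in compl F)}.
    by move=> C /sF; rewrite !mem_compl setCK orbC.
  rewrite -mem_compl in AF; rewrite -mem_compl in AF'.
  have := sides_separated (crossfree_compl cF) hF' sF' uS mA mA' AA' AF AF' aA aA'.
  by rewrite eD.
have [P mP yP] := mxs y.
have PS := maxsetp mP; have /imsetP[C CF EP] := PS.
have CB : C != B.
  by apply: contraTneq yP => EC; rewrite EP yside // EC eqxx.
have mB : maxset (mem (side @: F)) (xs B).
  apply/maxsetP; split; first by apply/imsetP; exists B; rewrite // /side eqxx.
  move=> _ /imsetP[D DF ->] /subsetP/(_ _ (xxs B)) xD.
  have [->|DB] := eqVneq D B; first by rewrite /side eqxx.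
  by rewrite (negPf (xside _ DB)) in xD.
have : xs B :|: P != setT by rewrite EP uB.
rewrite -subTset => /subsetPn[u _]; rewrite inE negb_or => /andP[uB' uP].
have [Q mQ uQ] := mxs u.
have xP : x \notin P by rewrite EP xside.
have BP : xs B != P by apply: contraNneq xP => <-.
have BQ : xs B != Q by apply: contraNneq uB' => ->.
have PQ : P != Q by apply: contraNneq uP => ->.
have [n1 n1'] := NI _ _ _ _ mB mP BP (xxs B) yP.
have [n2 n2'] := NI _ _ _ _ mB mQ BQ (xxs B) uQ.
have [n3 n3'] := NI _ _ _ _ mP mQ PQ yP uQ.
(* Three distinct maximal sides, [xs B], [P] through [y] and [Q] through [u], but only two types. *)
have := sF _ (maxsetp mB); have := sF _ (maxsetp mP); have := sF _ (maxsetp mQ).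
move: n1 n1' n2 n2' n3 n3'.
by case: (xs B \in F); case: (~: xs B \in F); case: (P \in F); case: (~: P \in F);
  case: (Q \in F); case: (~: Q \in F).
Qed.

Lemma connect_deleteS (D D' : {set V}) u v : D' \subset D ->
  connect (delete e D) u v -> connect (delete e D') u v.
Proof.
move=> /subsetP sub; apply: connect_sub => a b /and3P[eab aD bD].
by apply: connect1; rewrite /delete /= eab !(contra (sub _)).
Qed.

(** Both halves apply the spine condition at the node of [z] where the walk given by [link_approach]
    stops: towards a vertex [w] outside [B] for convexity, towards the head of [B'] for two disjoint
    members. *)
Lemma half_spine_nested Z F : treelike F -> half_spine Z F -> half_nested Z F.
Proof.
move=> tF hF; have [pF cF sF] := tF.
have N0 B : B \in F -> B != set0 by move=> BF; apply: contraNneq pF.1 => <-.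
split=> [B BF|B B' BF B'F dBB'].
  apply/forall_inP=> w; rewrite inE => /andP[wB wZ].
  apply/forall_inP=> u uB; apply/forall_inP=> v vB.
  have [A [a [z [BA wA l zw]]]] := link_approach tF BF wB.
  have cuv : connect (delete e (cl F z :&: Z)) u v.
    by rewrite (hF _ _ _ _ _ l l) ?eqxx ?(subsetP BA).
  case: zw => [zw|[A' [a' [AA' l' wA']]]].
    by apply: connect_deleteS cuv; rewrite sub1set inE zw cl_refl.
  have uD : u \notin cl F z :&: Z.
    rewrite !inE negb_and -cl_eq; apply/orP; left; apply/eqP=> /cl_mem E.
    by have [AF _ zA _] := linkP _ _ _ _ l; rewrite E // (subsetP BA) in zA.
  have [p [ep _ <- pD]] := connect_delete_path uD cuv.
  apply/connectP; exists p => //; apply: path_delete => // b bp; rewrite inE.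
  (* A path from [u] reaching [A'] would join the distinct incoming sets [A] and [A'] outside the
     deleted part of the node. *)
  apply: contraTneq wA' => <-; apply/negP=> bA'.
  have := hF _ _ _ _ _ l l' u b (subsetP BA _ uB) bA'.
  rewrite eq_sym (negPf AA') => /negP[].
  move: bp; rewrite inE => /predU1P[->//|/splitPr E].
  move: ep pD; case: E => p1 p2 ep pD; rewrite -cat_rcons cat_path in ep.
  apply/connectP; exists (rcons p1 b); rewrite ?last_rcons //.
  apply: path_delete => [|c cp]; first by case/andP: ep.
  by apply: pD; rewrite -cat_rcons -cat_cons mem_cat cp.
have [a' [b' l]] := link_exists pF sF B'F.
have [_ a'B' b'B' E] := linkP _ _ _ _ l.
have nBB' : B != B'.
  apply: contraTneq dBB' => ->; rewrite -setI_eq0 setIid; exact: N0.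
have a'B : a' \notin B by rewrite (disjointFl dBB' a'B').
have b'B : b' \notin B by rewrite -E.
have [u uB] := set0Pn _ (N0 _ BF).
have uB' : u \notin B' by rewrite (disjointFr dBB' uB).
have [A [a [z [BA b'A lA zb]]]] := link_approach tF BF b'B.
have [AF aA zA EA] := linkP _ _ _ _ lA.
(* If the walk stops at the head of [B'], then [B'] itself enters there; otherwise the other
   entering arc has [B'] behind it, by cross-freeness. *)
have [A' [c [lA' AA' BA']]] : exists A' c, [/\ link F A' c z, A' != A & B' \subset A'].
  case: zb => [zb|[A' [c [AA' lA' b'A']]]].
    exists B', a'; split; rewrite ?subxx //; first exact: link_cl (erefl _) (esym zb) l.
    by apply: contraNneq uB' => ->; apply: (subsetP BA).
  exists A', c; split=> //; have [A'F cA' zA' EA'] := linkP _ _ _ _ lA'.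
  have dAA' d : d \in A -> d \notin A'.
    move=> dA; apply/negP=> dA'.
    apply: (crossfree_quadrants cF AF A'F dA dA' aA _ _ cA' zA zA').
      by rewrite EA.
    by rewrite EA' // eq_sym.
  have B'A' : A' != B' by apply: contraNneq b'B' => <-.
  apply/subsetP=> d dB'; apply: contraT => dA'; exfalso.
  apply: (crossfree_quadrants cF A'F B'F _ a'B' b'A' b'B' dA' dB' _ uB').
    by rewrite E.
  by apply: dAA'; apply: (subsetP BA).
have [A'F cA' zA' _] := linkP _ _ _ _ lA'.
apply/negP=> cBB'.
have := hF _ _ _ _ _ lA lA' u a' (subsetP BA _ uB) (subsetP BA' _ a'B').
rewrite eq_sym (negPf AA') => /negP[].
apply: (convexb_connect_set treeT cBB'); rewrite ?inE ?uB ?a'B' ?orbT ?subsetIr //.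
rewrite -setI_eq0; apply/eqP/setP=> d; rewrite in_set0 in_setI in_setI in_setU.
apply/negP=> /andP[/andP[+ _] dBB]; rewrite inE -cl_eq => /eqP/cl_mem Ezd.
move: zA zA'; rewrite !Ezd //.
by case/orP: dBB => [/(subsetP BA)|/(subsetP BA')] ->.
Qed.

(** Since each [f r] is nonempty, its component is determined by any of its elements; this trades
    the choice function [K] for connectivity statements. *)
Lemma distinct_componentsP (D : {set V}) (I : {set {set V} * {set V}}) f :
  {in I, forall r, f r != set0} ->
  in_distinct_components e D I f <->
  {in I, forall r, [disjoint f r & D]} /\
  {in I &, forall r r', {in f r & f r',
     forall u v, connect (delete e D) u v = (r == r')}}.
Proof.
have dS := sym_connect_sym (delete_sym D eS).
have eqR : {in ~: D & &, equivalence_rel (connect (delete e D))}.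
  by move=> a b c _ _ _; split=> // ab; apply: (same_connect dS).
have partD := equivalence_partitionP eqR; have /and3P[/eqP covD trivD _] := partD.
pose R := equivalence_partition (connect (delete e D)) (~: D).
move=> fN; split=> [[K [KR fK Kinj]]|[fD fc]].
  have memD r u : r \in I -> u \in f r -> u \in ~: D.
    move=> Ir ur; rewrite -covD; apply/bigcupP; exists (K r); first exact: KR.
    exact: (subsetP (fK r Ir)).
  have Kp r u : r \in I -> u \in f r -> pblock R u = K r.
    by move=> Ir ur; apply: def_pblock => //; [apply: KR|apply: (subsetP (fK r Ir))].
  split=> [r Ir|r r' Ir Ir' u v ur vr].
    rewrite disjoint_subset; apply/subsetP=> u /(memD _ _ Ir); by rewrite !inE.
  rewrite -(pblock_equivalence_partition eqR (memD _ _ Ir ur) (memD _ _ Ir' vr)).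
  rewrite -eq_pblock ?covD ?(memD _ _ Ir ur) // -/R (Kp r) // (Kp r') //.
  by apply/eqP/eqP => [/Kinj->|->].
pose K r := if [pick u in f r] is Some u then pblock R u else set0.
have KP r : r \in I -> exists2 u, u \in f r & K r = pblock R u.
  move=> /fN/set0Pn[u ur]; rewrite /K; case: pickP => [v vr|/(_ u)]; first by exists v.
  by rewrite ur.
have inD r u : r \in I -> u \in f r -> u \in ~: D.
  by move=> Ir ur; rewrite inE (disjointFr (fD r Ir) ur).
exists K; split=> [r Ir|r Ir|r r' Ir Ir'].
- by have [u ur ->] := KP r Ir; rewrite pblock_mem // covD (inD r).
- have [u ur ->] := KP r Ir; apply/subsetP=> v vr.
  by rewrite (pblock_equivalence_partition eqR) ?(inD r) // (fc r r) ?eqxx.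
have [u ur ->] := KP r Ir; have [v vr ->] := KP r' Ir'.
have [uD vD] := (inD r u Ir ur, inD r' v Ir' vr).
move/eqP; rewrite eq_pblock ?covD // (pblock_equivalence_partition eqR) //.
by rewrite (fc r r') // => /eqP.
Qed.

(** Stated for an abstract [f] matching [I] with the links into [x], so as to serve both incoming
    arcs with [sc] and, on the complemented family, outgoing arcs with [sk]. *)
Lemma node_conditionP Z F x (I : {set {set V} * {set V}}) f :
  (forall r, r \in I -> exists y, link F (f r) y x) ->
  (forall B y, link F B y x -> exists2 r, r \in I & f r = B) ->
  {in I &, injective f} ->
  in_distinct_components e (cl F x :&: Z) I f <->
  (forall B B' y y', link F B y x -> link F B' y' x ->
     {in B & B', forall u v, connect (delete e (cl F x :&: Z)) u v = (B == B')}).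
Proof.
move=> If fI finj; have fN : {in I, forall r, f r != set0}.
  by move=> r /If[y /linkP[_ yr _ _]]; apply/set0Pn; exists y.
apply: (iff_trans (distinct_componentsP _ fN)).
split=> [[_ fc] B B' y y' l l' u v|H].
  have [r Ir <-] := fI _ _ l; have [r' Ir' <-] := fI _ _ l' => ur vr'.
  by rewrite (fc r r') // (inj_in_eq finj).
split=> [r /If[y /linkP[rF _ xr _]]|r r' Ir Ir' u v ur vr'].
  rewrite -setI_eq0; apply/eqP/setP=> d; rewrite in_set0 !in_setI.
  apply/negP=> /and3P[dr + _]; rewrite inE -cl_eq => /eqP/cl_mem/(_ rF) E.
  by rewrite E dr in xr.
have [y l] := If r Ir; have [y' l'] := If r' Ir'.
by rewrite (H _ _ _ _ l l') // (inj_in_eq finj).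
Qed.

Lemma signed_spineP neg F : [set: V] != set0 -> treelike F ->
  signed_spine e neg (spine_of F) <->
  half_spine neg F /\ half_spine (~: neg) (compl F).
Proof.
move=> VN tF; have [pF cF sF] := tF.
have inP x : in_distinct_components e (cl F x :&: neg)
    (incoming (spine_of F) (cl F x)) (sc (spine_of F)) <->
  (forall B B' y y', link F B y x -> link F B' y' x ->
     {in B & B', forall u v, connect (delete e (cl F x :&: neg)) u v = (B == B')}).
  have incE r : r \in incoming (spine_of F) (cl F x) ->
      exists y, link F (sc (spine_of F) r) y x /\ r = (cl F y, cl F x).
    rewrite inE => /andP[/arcs_spineP[B [y [x' [l ->]]]] /eqP/= Ex].
    by exists y; rewrite (sc_spine tF l) Ex; split=> //; apply: link_cl l.
  apply: node_conditionP
    => [r /incE[y [l _]]|B y l|r r' /incE[y [l ->]] /incE[y' [l' ->]] E].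
  - by exists y.
  - exists (cl F y, cl F x); last exact: sc_spine.
    by rewrite !inE eqxx andbT mem_arcs_spine; apply/existsP; exists B.
  rewrite (sc_spine tF l) (sc_spine tF l') in E; rewrite -E in l'.
  by have [-> _] := link_uniq cF l l'.
have outP x : in_distinct_components e (cl F x :&: ~: neg)
    (outgoing (spine_of F) (cl F x)) (sk (spine_of F)) <->
  (forall B B' y y', link (compl F) B y x -> link (compl F) B' y' x ->
     {in B & B', forall u v,
        connect (delete e (cl (compl F) x :&: ~: neg)) u v = (B == B')}).
  have outE r : r \in outgoing (spine_of F) (cl F x) ->
      exists B y, [/\ link F B x y, sk (spine_of F) r = ~: B & r = (cl F x, cl F y)].
    rewrite inE => /andP[/arcs_spineP[B [x' [y [l ->]]]] /eqP/= Ex].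
    by exists B, y; rewrite (sk_spine tF l) Ex; split=> //; apply: link_cl l.
  rewrite -cl_compl.
  apply: node_conditionP => [r|B y|r r']; rewrite ?cl_compl.
  - by move/outE=> [B [y [l -> _]]]; exists y; rewrite link_compl.
  - rewrite -[B]setCK link_compl => l; exists (cl F x, cl F y); last exact: sk_spine.
    by rewrite !inE eqxx andbT mem_arcs_spine; apply/existsP; exists (~: B).
  move=> /outE[B [y [l -> ->]]] /outE[B' [y' [l' -> ->]]] /setC_inj E.
  by rewrite -E in l'; have [_ ->] := link_uniq cF l l'.
split=> [[_ _ H1 H2]|[H1 H2]].
  by split=> x; [apply/inP/H1|apply/outP/H2]; apply: imset_f.
split; first exact: spine_directed_tree.
- exact: nodes_spine_partition.
- by move=> _ /imsetP[x _ ->]; apply/inP/H1.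
- by move=> _ /imsetP[x _ ->]; apply/outP/H2.
Qed.

End SignedTree.

(** * The source sets of a directed tree *)

Section DirectedTree.

Variable S : label_digraph V.
Hypothesis dtS : is_directed_tree (nodes S) (arcs S).
Hypothesis pS : partition (nodes S) [set: V].
Implicit Types (r a b : {set V} * {set V}) (X Y : {set V}).

Let del r := undirected (arcs S :\ r).
Let nd x := pblock (nodes S) x.

(** Node-level counterpart of [sc]; [mem_sc] relates the two. *)
Definition on_tail_side r U := connect (del r) r.1 U.

Lemma arc_asym U W : (U, W) \in arcs S -> (W, U) \notin arcs S.
Proof. exact: dtS.2. Qed.

Lemma arc_nodes r : r \in arcs S -> r.1 \in nodes S /\ r.2 \in nodes S.
Proof.
by case: r => U W UW; have [[_ H _ _ _] _] := dtS; apply: H; rewrite /undirected /= UW.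
Qed.

Lemma tail_side_tail r : on_tail_side r r.1.
Proof. exact: connect0. Qed.

(** As arcs are asymmetric, removing [r] removes its undirected edge, which is a bridge. *)
Lemma tail_side_head r : r \in arcs S -> ~~ on_tail_side r r.2.
Proof.
case: r => U W UW; have [[_ _ [GS GI] _ GA] _] := dtS.
have GUW : undirected (arcs S) U W by rewrite /undirected /= UW.
apply: contra ((acyclicP GS GI).1 GA _ _ GUW); apply: connect_sub => a b /= ab.
apply: connect1; rewrite /cut_edge; apply/and3P; split.
- by apply: (undirectedS (subD1set _ _)) ab.
- case/orP: ab; rewrite in_setD1 => /andP[// N ba].
  by apply: contraTneq ba => -[-> ->]; apply: arc_asym.
case/orP: ab; rewrite in_setD1 => /andP[N ab].
  by apply: contraTneq ab => -[-> ->]; apply: arc_asym.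
by apply: contraNneq N => -[-> ->].
Qed.

Let delS r := sym_connect_sym (@undirected_sym _ (arcs S :\ r)).

Lemma del_tail_side r U W : connect (del r) U W -> on_tail_side r U = on_tail_side r W.
Proof. by move=> UW; apply: (same_connect_r (delS r)). Qed.

Lemma tail_side_arc a b : b \in arcs S -> b != a -> on_tail_side a b.1 = on_tail_side a b.2.
Proof.
case: b => U W UW ba; apply: del_tail_side; apply: connect1.
by rewrite /del /undirected /= in_setD1 ba UW.
Qed.

(** The nodes still reachable from one of the two ends of [r] are closed under all edges, hence are
    all the nodes. *)
Lemma head_side r U : r \in arcs S -> U \in nodes S -> ~~ on_tail_side r U ->
  connect (del r) r.2 U.
Proof.
move=> rS US; have [[_ _ _ GC _] _] := dtS; have [r1S _] := arc_nodes rS.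
have cl : closed (undirected (arcs S))
    [pred W | on_tail_side r W || connect (del r) r.2 W].
  suff K X Y : (X, Y) \in arcs S -> on_tail_side r X || connect (del r) r.2 X =
                                     on_tail_side r Y || connect (del r) r.2 Y.
    by move=> X Y /orP[] /K; rewrite !inE => ->.
  move=> XY; have [<-|N] := eqVneq (X, Y) r.
    by rewrite (tail_side_tail (X, Y)) connect0 orbT.
  have c : connect (del r) X Y.
    by apply: connect1; rewrite /del /undirected /= in_setD1 N XY.
  rewrite (del_tail_side c); congr orb; exact: (same_connect_r (delS r)).
have := closed_connect cl (GC _ _ r1S US); rewrite !inE tail_side_tail /= => /esym.
by case: (on_tail_side r U).
Qed.

(** A duplicate-free path from [X] never returns to [X], so after its first arc [r] it stays on one
    side of [r]. *)
Lemma first_arc X Y : X \in nodes S -> Y \in nodes S -> X != Y ->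
  exists r Z, [/\ r \in arcs S, r = (X, Z) \/ r = (Z, X),
                  on_tail_side r X != on_tail_side r Y &
                  on_tail_side r Z = on_tail_side r Y].
Proof.
move=> XS YS XY; have [[_ _ _ GC _] _] := dtS.
have [q /shortenP[[_ _ _ E|Z p]]] := connectP (GC _ _ XS YS).
  by rewrite E eqxx in XY.
move=> /= /andP[XZ ZY] /andP[XN _] _ {q} EY.
have [r [rS Er]] : exists r, r \in arcs S /\ (r = (X, Z) \/ r = (Z, X)).
  by case/orP: XZ => ?; [exists (X, Z)|exists (Z, X)]; split; rewrite //; [left|right].
have ZYs : on_tail_side r Z = on_tail_side r Y.
  apply: del_tail_side; apply/connectP; exists p => //.
  apply: (@sub_in_path _ (predC1 X) (undirected (arcs S))); last exact: ZY.
    move=> U W; rewrite !inE => UX WX; rewrite /del /undirected /= !in_setD1.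
    by case: Er => ->; rewrite !xpair_eqE (negPf UX) (negPf WX) !(andbF, andFb).
  by apply/allP=> W WZ; apply: contraNneq XN => <-.
exists r, Z; split=> //; rewrite -ZYs.
case: Er rS => -> rS.
  by rewrite (tail_side_tail (X, Z)) (negPf (tail_side_head rS)).
by rewrite (tail_side_tail (Z, X)) (negPf (tail_side_head rS)).
Qed.

Lemma nd_nodes x : nd x \in nodes S.
Proof. by apply: pblock_mem; case/and3P: pS => /eqP-> _ _; rewrite inE. Qed.

Lemma nd_def U x : U \in nodes S -> x \in U -> nd x = U.
Proof. by move=> US xU; apply: def_pblock => //; case/and3P: pS. Qed.

Lemma mem_nd x : x \in nd x.
Proof. by rewrite mem_pblock; case/and3P: pS => /eqP-> _ _; rewrite inE. Qed.

Lemma node_has U : U \in nodes S -> exists x, x \in U.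
Proof.
by move=> US; apply/set0Pn; case/and3P: pS => _ _; apply: contraNneq => <-.
Qed.

Lemma mem_sc r z : (z \in sc S r) = on_tail_side r (nd z).
Proof. exact: side_pblock. Qed.

Let F := source_sets S.

Lemma sc_source r : r \in arcs S -> sc S r \in F.
Proof. by move=> rS; apply: imset_f. Qed.

Lemma sepset_nd x y : (sepset F x y == set0) = (nd x == nd y).
Proof.
apply/sepset0P/eqP => [E|E _ /imsetP[r rS ->]]; last by rewrite !mem_sc E.
apply/eqP; apply: contraT => /(first_arc (nd_nodes x) (nd_nodes y))[r [_ [rS _ + _]]].
by rewrite -!mem_sc E ?eqxx // sc_source.
Qed.

Lemma cl_nd x : cl F x = nd x.
Proof.
apply/setP=> y; rewrite inE sepset_nd eq_pblock //; first by case/and3P: pS.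
by case/and3P: pS => /eqP-> _ _; rewrite inE.
Qed.

Lemma arc_link r x y : r \in arcs S -> x \in r.1 -> y \in r.2 -> link F (sc S r) x y.
Proof.
move=> rS xr yr; have [r1S r2S] := arc_nodes rS.
have [Ex Ey] := (nd_def r1S xr, nd_def r2S yr).
apply/linkP; rewrite !mem_sc Ex Ey tail_side_tail tail_side_head ?sc_source //.
split=> // _ /imsetP[a aS ->] ar; rewrite !mem_sc Ex Ey tail_side_arc //.
by apply: contraNneq ar => ->.
Qed.

Lemma source_sets_stepwise : stepwise F.
Proof.
move=> x y; rewrite sepset_nd => /(first_arc (nd_nodes x) (nd_nodes y)).
case=> r [Z [rS Er xy _]]; have [z zZ] : exists z, z \in Z.
  by have [] := arc_nodes rS; case: Er => -> /= *; apply: node_has.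
exists (sc S r), z; rewrite inE sc_source // !mem_sc xy; split=> //.
by case: Er rS => -> rS; [|rewrite sepset_sym]; apply: link_sepset;
  apply: arc_link; rewrite //= mem_nd.
Qed.

Lemma source_sets_nontrivial : nontrivial F.
Proof.
split; apply/imsetP=> -[r rS]; have [r1S r2S] := arc_nodes rS.
  have [x xr] := node_has r1S => /setP/(_ x).
  by rewrite mem_sc (nd_def r1S xr) tail_side_tail inE.
have [x xr] := node_has r2S => /setP/(_ x).
by rewrite mem_sc (nd_def r2S xr) (negPf (tail_side_head rS)) inE.
Qed.

(** The part of the tree cut off by [b] away from the tail of [a] is connected and does not use the
    arc [a]. *)
Lemma tail_side_far a b X Y : a \in arcs S -> b \in arcs S -> a != b ->
  X \in nodes S -> Y \in nodes S ->
  on_tail_side b X != on_tail_side b a.1 -> on_tail_side b Y != on_tail_side b a.1 ->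
  on_tail_side a X = on_tail_side a Y.
Proof.
move=> aS bS ab XS YS Xa Ya; have [r1S r2S] := arc_nodes bS.
have cXY : connect (del b) X Y.
  have XYb : on_tail_side b X = on_tail_side b Y.
    by move: Xa Ya; case: (on_tail_side b X); case: (on_tail_side b Y);
       case: (on_tail_side b a.1).
  case bX: (on_tail_side b X); move: (bX); rewrite XYb => bY.
    by apply: (connect_trans (y := b.1)); rewrite // delS.
  apply: (connect_trans (y := b.2)); first by rewrite delS head_side ?bX.
  by rewrite head_side ?bY.
pose P := [pred U : {set V} | (on_tail_side b U == on_tail_side b a.1)
                             || (on_tail_side a U == on_tail_side a X)].
have clP : closed (del b) P.
  move=> U W UW; rewrite !inE (del_tail_side (connect1 UW)).
  have [//|bW] := eqVneq (on_tail_side b W) _; rewrite !orFb; congr (_ == _).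
  case/orP: UW (connect1 UW) => /setD1P[_ UW] c.
    apply: (@tail_side_arc a (U, W)) => //; apply: contraNneq bW => <-.
    by rewrite (del_tail_side c).
  apply/esym/(@tail_side_arc a (W, U)) => //; apply: contraNneq bW => <-.
  by rewrite eqxx.
by have := closed_connect clP cXY; rewrite !inE eqxx orbT (negPf Ya) => /esym/eqP->.
Qed.

(** By [tail_side_far], one side of [b] lies entirely on one side of [a], which empties a
    quadrant. *)
Lemma source_sets_crossfree : crossfree F.
Proof.
move=> _ _ /imsetP[a aS ->] /imsetP[b bS ->].
have [->|ab] := eqVneq a b; first by rewrite subxx.
have H x y : on_tail_side b (nd x) != on_tail_side b a.1 ->
    on_tail_side b (nd y) != on_tail_side b a.1 -> (x \in sc S a) = (y \in sc S a).
  by rewrite !mem_sc; apply: tail_side_far; rewrite // nd_nodes.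
apply: contraT; rewrite !negb_or => /and4P[].
move=> /subsetPn[x2 x2A x2A'] /subsetPn[x3 x3A' x3A].
rewrite -setI_eq0 => /set0Pn[x1]; rewrite inE => /andP[x1A x1A'].
rewrite -subTset => /subsetPn[x4 _]; rewrite inE negb_or => /andP[x4A x4A'].
rewrite !mem_sc in H x2A' x3A' x1A' x4A'.
case Ea: (on_tail_side b a.1) H => H.
  by have := H x2 x4; rewrite (negPf x2A') (negPf x4A') x2A (negPf x4A) => /(_ isT isT).
by have := H x1 x3; rewrite x1A' x3A' x1A (negPf x3A) => /(_ isT isT).
Qed.

Lemma source_sets_treelike : treelike F.
Proof.
split; [exact: source_sets_nontrivial|exact: source_sets_crossfree|].
exact: source_sets_stepwise.
Qed.

Lemma spine_of_source_sets : spine_of F = S.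
Proof.
have EN : [set cl F x | x : V] = nodes S.
  apply/setP=> U; apply/imsetP/idP => [[x _ ->]|US]; first by rewrite cl_nd nd_nodes.
  by have [x xU] := node_has US; exists x; rewrite // cl_nd (nd_def US).
suff EA : arcs (spine_of F) = arcs S by move: EA; rewrite /spine_of EN /= => ->; case: (S).
apply/setP=> r; apply/arcs_spineP/idP => [[B [x [y [l ->]]]]|rS]; last first.
  have [r1S r2S] := arc_nodes rS.
  have [[x xr] [y yr]] := (node_has r1S, node_has r2S).
  exists (sc S r), x, y; split; first exact: arc_link.
  by rewrite !cl_nd (nd_def r1S) ?(nd_def r2S) // -surjective_pairing.
have [BF xB yB _] := linkP _ _ _ _ l.
have xy : nd x != nd y.
  by rewrite -sepset_nd (link_sepset l); apply/set0Pn; exists B; rewrite inE.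
(* The first arc from [x] towards [y] must have source set [B], and after crossing it no separator
   from [y] is left. *)
have [a [Z [aS Ea xya _]]] := first_arc (nd_nodes x) (nd_nodes y) xy.
have ZS : Z \in nodes S by have [] := arc_nodes aS; case: Ea => ->.
have [z zZ] := node_has ZS.
have EB : sc S a = B.
  by apply/set1P; rewrite -(link_sepset l) inE sc_source // !mem_sc.
case: Ea aS EB => -> aS EB; last first.
  by have /linkP[_ _] := arc_link aS zZ (mem_nd x); rewrite EB xB.
have xz := link_sepset (arc_link aS (mem_nd x) zZ); rewrite EB in xz.
have : sepset F z y == set0.
  by rewrite (sepset_step xz) (link_sepset l) ?set11 // setDv.
by rewrite sepset_nd (nd_def ZS zZ) !cl_nd => /eqP <-.
Qed.

End DirectedTree.

(** * Contractions *)

Lemma sepset_del F B x y : sepset (F :\ B) x y = sepset F x y :\ B.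
Proof. by apply/setP=> C; rewrite !inE andbA. Qed.

Lemma link_restrict F G B x y : G \subset F -> B \in G -> link F B x y -> link G B x y.
Proof.
move=> /subsetP GF BG /linkP[_ xB yB E].
by apply/linkP; split=> // C /GF; apply: E.
Qed.

Lemma sc_spine_inj F : treelike F ->
  {in arcs (spine_of F) &, injective (sc (spine_of F))}.
Proof.
move=> tF _ _ /arcs_spineP[B [x [y [l ->]]]] /arcs_spineP[B' [x' [y' [l' ->]]]].
rewrite (sc_spine tF l) (sc_spine tF l') => E; rewrite -E in l'.
by have [_ cF _] := tF; have [-> ->] := link_uniq cF l l'.
Qed.

(** Removing [B] adds to the class of [z] only vertices that [B] alone separates from [z]; by
    uniqueness of links, this happens just at the two ends of the arc of [B]. *)
Lemma merge_cl F B x y z : crossfree F -> link F B x y ->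
  Defs.merge (cl F x, cl F y) (cl F z) = cl (F :\ B) z.
Proof.
move=> cF l; have xy := link_sepset l.
have H u v : sepset F u v = [set B] -> cl F u :|: cl F v = cl (F :\ B) u.
  move=> uv; apply/setP=> w; rewrite !inE sepset_del.
  have [Buw|Buw] := boolP (B \in sepset F u w).
    rewrite (sepset_step uv Buw) orb_idl // => /eqP E.
    by rewrite E inE in Buw.
  have -> : sepset F u w :\ B = sepset F u w.
    by apply/setDidPl; rewrite disjoint_sym disjoints1.
  rewrite orb_idr // => vw; have /eqP Evw : cl F v == cl F w by rewrite cl_eq.
  have BF : B \in F by have := set11 B; rewrite -uv inE => /andP[].
  have := set11 B; rewrite -uv inE (cl_mem Evw BF) => /andP[_ N].
  by move: Buw; rewrite inE BF N.
rewrite /Defs.merge /=; have [/eqP zx|zx] := boolP (cl F z == cl F x).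
  rewrite (H _ _ xy); apply/eqP; rewrite cl_eq sepset_del.
  by move/eqP: zx; rewrite cl_eq sepset_sym => /eqP->; rewrite set0D.
have [/eqP zy|zy] := boolP (cl F z == cl F y).
  rewrite setUC (H y x) 1?sepset_sym //; apply/eqP; rewrite cl_eq sepset_del.
  by move/eqP: zy; rewrite cl_eq sepset_sym => /eqP->; rewrite set0D.
apply/setP=> w; rewrite !inE sepset_del; apply/idP/idP => [/eqP->|]; first by rewrite set0D.
rewrite setD_eq0 subset1 => /orP[/eqP zw|//].
case/orP: (sepset1_link zw) => lz.
  by have [E _] := link_uniq cF lz l; rewrite E eqxx in zx.
by have [_ E] := link_uniq cF lz l; rewrite E eqxx in zy.
Qed.

(** Links of the other members survive the removal of [B]; conversely each remaining member has a
    link in [F], which by uniqueness represents its arc in the smaller family too. *)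
Lemma contract_arc_spine F B x y : treelike F -> link F B x y ->
  contract_arc (spine_of F) (cl F x, cl F y) = spine_of (F :\ B).
Proof.
move=> [pF cF sF] l; have sub := subD1set F B.
have cFB : crossfree (F :\ B) by move=> C D /(subsetP sub) CF /(subsetP sub) DF; apply: cF.
rewrite /contract_arc /=; congr LabelDigraph.
  by rewrite -imset_comp; apply: eq_imset => z /=; apply: merge_cl.
apply/setP=> r; apply/imsetP/arcs_spineP => [[a]|[C [x' [y' [l' ->]]]]].
  rewrite in_setD1 => /andP[aN /arcs_spineP[C [x' [y' [l' Ea]]]]] ->.
  exists C, x', y'; rewrite Ea /= !(merge_cl _ cF l); split=> //.
  apply: (link_restrict sub _ l'); rewrite in_setD1; have [-> _ _ _] := linkP _ _ _ _ l'.
  rewrite andbT; apply: contraNneq aN => EC; rewrite EC in l'.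
  by rewrite Ea; have [-> ->] := link_uniq cF l l'.
have [CFB _ _ _] := linkP _ _ _ _ l'; move: (CFB); rewrite in_setD1 => /andP[CB CF].
have [x0 [y0 l0]] := link_exists pF sF CF.
have [Ex Ey] := link_uniq cFB l' (link_restrict sub CFB l0).
exists (cl F x0, cl F y0); last by rewrite /= !(merge_cl _ cF l) Ex Ey.
rewrite in_setD1 mem_arcs_spine; apply/andP; split; last by apply/existsP; exists C.
apply: contraNneq CB => -[E1 E2]; have := link_sepset (link_cl E1 E2 l0).
by rewrite (link_sepset l) => /set1_inj ->.
Qed.

(** Invariant of the iteration: the current digraph is the spine of the surviving subfamily [G], and
    [m] sends classes of [F] to classes of [G]. *)
Lemma contract_seq_spine F G m (rs : seq ({set V} * {set V})) :
  (forall H : {set {set V}}, H \subset F -> treelike H) -> G \subset F ->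
  uniq rs -> {subset rs <= arcs (spine_of F)} ->
  {in rs, forall r, sc (spine_of F) r \in G} ->
  (forall x, m (cl F x) = cl G x) ->
  contract_seq (spine_of G) m rs =
    spine_of (G :\: [set sc (spine_of F) r | r in rs]).
Proof.
move=> tH; elim: rs G m => [|r rs IH] G m GF /= => [_ _ _ _|/andP[rN urs] sub scG mE].
  by congr spine_of; apply/setP=> B; rewrite inE; case: imsetP => // -[].
have tF := tH _ (subxx F); have [_ cG _] := tH _ GF.
have rA : r \in arcs (spine_of F) by apply: sub; rewrite inE eqxx.
have := rA; case/arcs_spineP=> B [x [y [l Er]]].
have EB : sc (spine_of F) r = B by rewrite Er; apply: sc_spine.
have BG : B \in G by rewrite -EB scG // inE eqxx.
have lG := link_restrict GF BG l.
rewrite Er /= !mE (contract_arc_spine (tH _ GF) lG) -Er IH //.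
- congr spine_of; apply/setP=> C; rewrite !inE andbA -negb_or; congr (~~ _ && _).
  apply/orP/imsetP => [[/imsetP[a ars ->]|/eqP->]|[a]].
  + by exists a; rewrite // inE ars orbT.
  + by exists r; rewrite ?EB // inE eqxx.
  by rewrite inE => /predU1P[->|ars] ->; [right; rewrite EB|left; apply: imset_f].
- exact: subset_trans (subD1set _ _) GF.
- by move=> a ars; apply: sub; rewrite inE ars orbT.
- move=> a ars; have ars' : a \in r :: rs by rewrite inE ars orbT.
  rewrite in_setD1 scG // andbT -EB; apply: contraNneq rN => E.
  by rewrite -(sc_spine_inj tF _ _ E) // sub.
by move=> z /=; rewrite mE (merge_cl _ cG lG).
Qed.

Lemma contract_spine F (R : {set {set V} * {set V}}) :
  (forall H : {set {set V}}, H \subset F -> treelike H) -> R \subset arcs (spine_of F) ->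
  contract (spine_of F) R = spine_of (F :\: [set sc (spine_of F) r | r in R]).
Proof.
move=> tH /subsetP sub; rewrite /contract (contract_seq_spine tH) ?enum_uniq //.
- congr (spine_of (_ :\: _)); apply/setP=> B.
  by apply/imsetP/imsetP => -[r rR ->]; exists r; rewrite // ?mem_enum // -mem_enum.
- by move=> r; rewrite mem_enum; apply: sub.
move=> r; rewrite mem_enum => /sub rA.
by rewrite -{2}(source_sets_spine (tH _ (subxx F))); apply: imset_f.
Qed.

End SplitSystems.

(** * The correspondence between spines and nested families *)

(** Signed nestedness passes to subfamilies, which supplies the hypothesis on all subfamilies in
    [contract_spine]. *)
Lemma signed_nested_treelike (V : finType) (e : rel V) neg (F G : {set {set V}}) :
  is_tree [set: V] e -> signed_nested e neg F -> G \subset F -> treelike G.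
Proof.
move=> treeT [rF cF] /subsetP GF.
have : signed_nested e neg G by split=> [B /GF/rF//|B C /GF BF /GF CF]; apply: cF.
case/(signed_nestedP treeT) => pG cG hG hG'; split=> //.
exact: (half_nested_stepwise treeT pG cG hG hG').
Qed.

Lemma signed_spine_nested (V : finType) (e : rel V) neg (S : label_digraph V) :
  is_tree [set: V] e -> signed_spine e neg S -> signed_nested e neg (source_sets S).
Proof.
move=> treeT spS; have [dS pS _ _] := spS.
have tF := source_sets_treelike dS pS; have [pF cF _] := tF.
have VN : [set: V] != set0 by case: treeT.
move: spS; rewrite -{1}(spine_of_source_sets dS pS).
case/(signed_spineP treeT _ VN tF) => h h'; apply/(signed_nestedP treeT); split=> //.
  exact: (half_spine_nested treeT tF).
exact: (half_spine_nested treeT (treelike_compl tF)).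
Qed.

Theorem theorem30 (V : finType) (e : rel V) (neg : {set V})
    (treeT : is_tree [set: V] e) :
  [/\ (forall S : label_digraph V, signed_spine e neg S ->
         signed_nested e neg (source_sets S)),
      (forall S S' : label_digraph V,
         signed_spine e neg S -> signed_spine e neg S' ->
         source_sets S = source_sets S' -> S = S'),
      (forall F : {set {set V}}, signed_nested e neg F ->
         exists2 S : label_digraph V, signed_spine e neg S & source_sets S = F) &
      (forall S S' : label_digraph V,
         signed_spine e neg S -> signed_spine e neg S' ->
         (contraction_of S S' <-> source_sets S \subset source_sets S'))].
Proof.
have VN : [set: V] != set0 by case: treeT.
have spineK S : signed_spine e neg S -> spine_of (source_sets S) = S.
  by case=> dS pS _ _; apply: spine_of_source_sets.
split.
- by move=> S; apply: signed_spine_nested.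
- by move=> S S' /spineK + /spineK + E; rewrite E => -> .
- move=> F nF; have tF := signed_nested_treelike treeT nF (subxx F).
  have [_ cF hF hF'] := (signed_nestedP treeT _ _).1 nF.
  exists (spine_of F); last exact: source_sets_spine.
  apply/(signed_spineP treeT _ VN tF); split; first exact: half_nested_spine.
  exact: half_nested_spine (crossfree_compl cF) hF'.
move=> S S' spS spS'; set F := source_sets S; set F' := source_sets S'.
have tF' G := signed_nested_treelike (G := G) treeT (signed_spine_nested treeT spS').
have tF := signed_nested_treelike treeT (signed_spine_nested treeT spS) (subxx F).
rewrite -{1}(spineK _ spS) -{1}(spineK _ spS') -/F -/F'; split.
  case=> R RA; rewrite (contract_spine tF' RA) => E.
  move/(congr1 (@source_sets V)): E; rewrite (source_sets_spine tF).
  by rewrite (source_sets_spine (tF' _ (subsetDl _ _))) => ->; apply: subsetDl.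
(* Contract exactly the arcs whose source sets have to disappear. *)
move=> FF'; pose R := [set r in arcs (spine_of F') | sc (spine_of F') r \notin F].
have RA : R \subset arcs (spine_of F') by apply/subsetP=> r; rewrite inE => /andP[].
exists R => //; rewrite (contract_spine tF' RA); congr spine_of.
apply/setP=> B; rewrite inE; apply/idP/andP => [BF|[BR BF']].
  split; last exact: (subsetP FF').
  by apply/imsetP=> -[r + E]; rewrite inE -E BF andbF.
have /imsetP[r rA E] : B \in source_sets (spine_of F').
  by rewrite (source_sets_spine (tF' _ (subxx _))).
apply: contraNT BR => BF; apply/imsetP; exists r => //.
by rewrite inE rA -E.
Qed.
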